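(* Let $n\ge2$ and let $(a,b)$ be an open interval. If $f:(a,b)\to\mathbb{R}$ is $n$-convex, then for any $\lambda_0\in(a,b)$ the function $g:(a,b)\to\mathbb{R}$, $g(x)=[x,\lambda_0]_f$, is $n$-monotone.
   Context: A function $f:(a,b)\to\mathbb{R}$ is called matrix convex of order $n$ ($n$-convex) if for all $n\times n$ Hermitian matrices $A,B$ with spectra in $(a,b)$ and all $\lambda\in[0,1]$ one has $f(\lambda A+(1-\lambda)B)\le\lambda f(A)+(1-\lambda)f(B)$. A function $g:(a,b)\to\mathbb{R}$ is called matrix monotone of order $n$ ($n$-monotone) if for all $n\times n$ Hermitian matrices $A,B$ with spectra in $(a,b)$ and $A\le B$ one has $g(A)\le g(B)$. Here $f(A)$ is defined by the functional calculus, and $X\le Y$ means that $Y-X$ is positive semi-definite. The divided difference is $[x,\lambda_0]_f=\frac{f(x)-f(\lambda_0)}{x-\lambda_0}$ for $x\neq\lambda_0$ and $[\lambda_0,\lambda_0]_f=f'(\lambda_0)$ (an $n$-convex function with $n\ge2$ is known to be $C^2$). *)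

(* Defs.v *)
(* MathComp, real-closed (R[i]) and MathComp-Analysis. *)
From HB Require Import structures.
From mathcomp Require Import all_boot all_order all_algebra.
From mathcomp Require Import sesquilinear spectral.
From mathcomp.real_closed Require Import complex.
From mathcomp Require Import all_classical all_reals all_analysis.

Set Implicit Arguments.
Unset Strict Implicit.
Unset Printing Implicit Defensive.

Import Order.TTheory GRing.Theory Num.Theory.
Import numFieldNormedType.Exports.

Local Open Scope ring_scope.
Local Open Scope sesquilinear_scope.
Local Open Scope complex_scope.

(* Functions (a, b) -> R are represented by total functions R -> R; the notions
   below only ever look at the values taken on (a, b).  The endpoints are
   extended reals, so that unbounded open intervals are covered as well. *)
Definition in_oo (R : realType) (a b : \bar R) (x : R) : Prop :=
  (a < x%:E < b)%E.

Definition spectrum_in (R : realType) (n : nat) (a b : \bar R)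
    (A : 'M[R[i]]_n) : Prop :=
  forall z : R[i], eigenvalue A z -> exists2 x : R, in_oo a b x & z = x%:C.

(* In the order of R[i], 0 <= z means that z is real and nonnegative. *)
Definition psdmx (R : realType) (n : nat) (A : 'M[R[i]]_n) : Prop :=
  A \is hermsymmx /\ forall v : 'cV[R[i]]_n, 0 <= (v ^t* *m A *m v) 0 0.

Definition loewner_le (R : realType) (n : nat) (A B : 'M[R[i]]_n) : Prop :=
  psdmx (B - A).

(* For Hermitian A, orthomx_spectralP gives A = P^-1 D P with P := spectralmx A
   unitary and D the diagonal matrix of the (real) eigenvalues of A, listed by
   spectral_diag A; f is applied to these eigenvalues.  The result does not
   depend on the chosen diagonalisation.  The value at a non-Hermitian A is
   irrelevant. *)
Definition fun_calc (R : realType) (n : nat) (f : R -> R)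
    (A : 'M[R[i]]_n) : 'M[R[i]]_n :=
  invmx (spectralmx A)
    *m diag_mx (map_mx (fun z : R[i] => (f (complex.Re z))%:C) (spectral_diag A))
    *m spectralmx A.

Definition matrix_convex (R : realType) (n : nat) (a b : \bar R)
    (f : R -> R) : Prop :=
  forall (A B : 'M[R[i]]_n) (l : R),
    A \is hermsymmx -> B \is hermsymmx ->
    spectrum_in a b A -> spectrum_in a b B ->
    0 <= l <= 1 ->
    loewner_le (fun_calc f (l%:C *: A + (1 - l)%:C *: B))
               (l%:C *: fun_calc f A + (1 - l)%:C *: fun_calc f B).

Definition matrix_monotone (R : realType) (n : nat) (a b : \bar R)
    (g : R -> R) : Prop :=
  forall A B : 'M[R[i]]_n,
    A \is hermsymmx -> B \is hermsymmx ->
    spectrum_in a b A -> spectrum_in a b B ->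
    loewner_le A B ->
    loewner_le (fun_calc g A) (fun_calc g B).

(* derive1 f x0 is a total derivative, meaningful where f is derivable; a matrix
   convex function of order n >= 2 on an open interval is C^2 there. *)
Definition divided_difference (R : realType) (f : R -> R) (x x0 : R) : R :=
  if x == x0 then derive1 f x0 else (f x - f x0) / (x - x0).

(* Main.v *)
Require Import Defs.
From HB Require Import structures.
From mathcomp Require Import all_boot all_order all_algebra.
From mathcomp Require Import sesquilinear spectral.
From mathcomp.real_closed Require Import complex.
From mathcomp Require Import all_classical all_reals all_analysis.
From mathcomp Require Import ring lra zify.

Set Implicit Arguments.
Unset Strict Implicit.
Unset Printing Implicit Defensive.

Import Order.TTheory GRing.Theory Num.Theory.
Import numFieldNormedType.Exports.

Local Open Scope ring_scope.

(* Let g = [., lambda0]_f.  Everything is reduced to divided differences of f q^2 and of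
   g q^2, where q is a polynomial of degree less than n.

   1. Kraus' inequality.  If a polynomial P >= f touches f at d_1, ..., d_n, then
      convexity for A = diag(d) + E and B = diag(d) - s E with E = kappa tau tau^T,
      tau = (eps, ..., eps, 1), bounds a polynomial expression in P; letting s = eps^2
      tend to 0 shows that the matrix ([d_i, d_j, e]_P) is positive semi-definite.
      This is the nonnegativity of the divided difference of f q^2 at the nodes
      d_1, d_1, ..., d_n, d_n, e.
   2. Knot insertion replaces the double nodes by arbitrary distinct nodes.  Points where
      f is touched from above by a polynomial are dense (f is convex), so by continuity
      every divided difference of f q^2 at 2n+1 distinct nodes is nonnegative, and no
      smoothness of f has to be known beforehand.  For q = 1 and five
      equidistant nodes this forces f to be differentiable, so that g is continuous, and
      taking lambda0 as one of the nodes yields the same for g q^2 at 2n distinct nodes.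
   3. If B = A + w w^*, the resolvent identity gives
        v^* (t - B)^-1 v - v^* (t - A)^-1 v = |q(t)|^2 / (chi_A(t) chi_B(t))
      with deg q < n, hence v^* (g(B) - g(A)) v is a divided difference of g |q|^2 at the
      eigenvalues of A and B.  A general A <= B is reached by rank-one steps. *)

(** * Residues of rational functions *)

Section Residue.
Variable F : fieldType.
Implicit Types (p q r w : {poly F}) (x y : F).

(** For monic [w] this is the coefficient of 1/t in the expansion of p/w at infinity, that is, the
    sum of the residues of p/w at its poles. It extends divided differences of [p] to repeated
    nodes. *)
Definition presidue p w : F := (p %% w)`_(size w).-2.

Lemma coef_mul_monic_top p r k :
  (size p <= k.+1)%N -> r \is monic -> (p * r)`_(k + (size r).-1) = p`_k.
Proof.
move=> sp rm.
have r0 : (0 < size r)%N by rewrite size_poly_gt0 monic_neq0.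
rewrite coefM.
have kl : (k < (k + (size r).-1).+1)%N by rewrite ltnS leq_addr.
rewrite (bigD1 (Ordinal kl)) //= addKn.
rewrite -[r`__]/(lead_coef r) (eqP rm) mulr1 big1 ?addr0 // => i ik.
have [ik'|ik'|/eqP ik'] := ltngtP i k.
- have aux (s j : nat) : (0 < s -> j < k -> s <= k + s.-1 - j)%N by lia.
  by rewrite [r`__]nth_default ?mulr0 // aux.
- by rewrite nth_default ?mul0r // (leq_trans sp).
- by move: ik; rewrite -val_eqE /= ik'.
Qed.

Lemma presidueD p q w : presidue (p + q) w = presidue p w + presidue q w.
Proof. by rewrite /presidue modpD coefD. Qed.

Lemma presidueZ c p w : presidue (c *: p) w = c * presidue p w.
Proof. by rewrite /presidue modpZl coefZ. Qed.

Lemma presidueN p w : presidue (- p) w = - presidue p w.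
Proof. by rewrite -scaleN1r presidueZ mulN1r. Qed.

Lemma presidue0 w : presidue 0 w = 0.
Proof. by rewrite -(scale0r 0) presidueZ mul0r. Qed.

Lemma presidue_sum (I : Type) (s : seq I) (P : pred I) (G : I -> {poly F}) w :
  presidue (\sum_(i <- s | P i) G i) w = \sum_(i <- s | P i) presidue (G i) w.
Proof.
by elim/big_rec2: _ => [|i x y _ <-]; rewrite ?presidue0 ?presidueD.
Qed.

Lemma presidue_modp p w : presidue (p %% w) w = presidue p w.
Proof. by rewrite /presidue modp_id. Qed.

(** Here p/w is O(t^-2) at infinity: a divided difference of order above the degree vanishes. *)
Lemma presidue_small p w : ((size p).+1 < size w)%N -> presidue p w = 0.
Proof.
move=> pw; rewrite /presidue modp_small; last exact: ltn_trans pw.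
have aux (a b : nat) : (a.+1 < b -> a <= b.-2)%N by lia.
by rewrite nth_default // aux.
Qed.

(** The quotient p/w does not see a common factor: in the new remainder [(p %% w) * r] the relevant
    coefficient meets only the leading coefficient of [r]. *)
Lemma presidue_mul2r p w r : w \is monic -> r \is monic ->
  presidue (p * r) (w * r) = presidue p w.
Proof.
move=> wm rm; have w0 := monic_neq0 wm; have r0 := monic_neq0 rm.
have sw : (0 < size w)%N by rewrite size_poly_gt0.
have sr : (0 < size r)%N by rewrite size_poly_gt0.
rewrite /presidue {1}(divp_eq p w) mulrDl -mulrA modpD modp_mull add0r.
have sm : (size (p %% w)%R < size w)%N by rewrite ltn_modp.
rewrite modp_small; last first.
  have [->|m0] := eqVneq (p %% w) 0.
    by rewrite mul0r size_poly0 size_poly_gt0 mulf_neq0.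
  have aux (a b c : nat) : (a < b -> 0 < c -> (a + c).-1 < (b + c).-1)%N by lia.
  by rewrite !size_mul // aux.
(* A constant [w] is treated apart, since the truncated predecessors do not add up there; both sides
   are then zero. *)
rewrite size_mul //; move: sw; rewrite leq_eqVlt => /orP[/eqP sw|sw].
  have -> : p %% w = 0.
    by apply/eqP; rewrite -size_poly_eq0 -leqn0 -ltnS sw.
  by rewrite mul0r !coef0.
have aux (b c : nat) : (1 < b -> 0 < c -> (b + c).-1.-2 = b.-2 + c.-1)%N by lia.
have aux' (a b : nat) : (a < b -> 1 < b -> a <= b.-2.+1)%N by lia.
by rewrite aux // coef_mul_monic_top // aux'.
Qed.

Lemma presidue_mul2l p w r : w \is monic -> r \is monic ->
  presidue (r * p) (r * w) = presidue p w.
Proof. by move=> wm rm; rewrite mulrC (mulrC r) presidue_mul2r. Qed.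

Lemma presidue_XsubC p x : presidue p ('X - x%:P) = p.[x].
Proof. by rewrite /presidue modp_XsubC size_XsubC coefC. Qed.

Lemma size_prod_XsubC_neq (m : nat) (x : 'I_m -> F) (i : 'I_m) :
  size (\prod_(j | j != i) ('X - (x j)%:P)) = m.
Proof.
rewrite -big_filter size_prod_XsubC; rewrite (_ : size _ = m.-1); last first.
  have [e _ _ [_ ->]] := big_enumP; have := cardC1 i; rewrite card_ord (eq_card (B := [pred j | j != i])) // => ->.
by case: m x i => [_ []|].
Qed.

Lemma horner_prod_XsubC (I : Type) (s : seq I) (P : pred I) (x : I -> F) y :
  (\prod_(j <- s | P j) ('X - (x j)%:P)).[y] = \prod_(j <- s | P j) (y - x j).
Proof. by rewrite horner_prod; apply: eq_bigr => j _; rewrite hornerXsubC. Qed.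

(** Lagrange interpolation: the difference of the two sides has size at most [m] and [m] distinct
    roots. *)
Lemma lagrange_decomp (m : nat) (x : 'I_m -> F) p : injective x ->
  (size p <= m)%N ->
  p = \sum_i (p.[x i] / \prod_(j | j != i) (x i - x j))
        *: \prod_(j | j != i) ('X - (x j)%:P).
Proof.
move=> xI sp; apply/eqP; rewrite -subr_eq0; apply/eqP.
set r := p - _.
apply: (@roots_geq_poly_eq0 _ r [seq x i | i <- enum 'I_m]).
- apply/allP => _ /mapP[i _ ->]; rewrite /root /r hornerD hornerN.
  rewrite horner_sum (bigD1 i) //= [X in _ - (_ + X)]big1 ?addr0.
    rewrite hornerZ horner_prod_XsubC divfK ?subrr //; apply/prodf_neq0 => j ji.
    by rewrite subr_eq0 (inj_eq xI) eq_sym.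
  move=> k ki; rewrite hornerZ horner_prod_XsubC.
  by rewrite [X in _ * X](bigD1 i) 1?eq_sym //= subrr mul0r mulr0.
- by rewrite map_inj_uniq // enum_uniq.
rewrite size_map size_enum_ord; apply: leq_trans (size_polyD _ _) _.
rewrite geq_max sp size_polyN; apply: leq_trans (size_sum _ _ _) _.
apply/bigmax_leqP => i _; apply: leq_trans (size_scale_leq _ _) _.
by rewrite size_prod_XsubC_neq.
Qed.

(** Partial fractions: after Lagrange interpolation of the remainder, each basis polynomial over the
    full product reduces to 1/(X - x_i), whose residue is 1. The result is the classical divided
    difference. *)
Lemma presidue_prod_XsubC (m : nat) (x : 'I_m -> F) p : injective x ->
  presidue p (\prod_i ('X - (x i)%:P))
  = \sum_i p.[x i] / \prod_(j | j != i) (x i - x j).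
Proof.
move=> xI; set w := \prod_i _.
have wm : w \is monic by apply: monic_prod_XsubC.
have sw : size w = m.+1.
  by rewrite /w size_prod_XsubC /index_enum -enumT size_enum_ord.
rewrite -presidue_modp {1}(@lagrange_decomp _ x (p %% w) xI); last first.
  by rewrite -ltnS -sw ltn_modp monic_neq0.
rewrite presidue_sum; apply: eq_bigr => i _; rewrite presidueZ.
have -> : (p %% w).[x i] = p.[x i].
  rewrite {2}(divp_eq p w) hornerD hornerM.
  by rewrite (_ : w.[x i] = 0) ?mulr0 ?add0r // horner_prod (bigD1 i) //= hornerXsubC subrr mul0r.
have -> : w = ('X - (x i)%:P) * \prod_(j | j != i) ('X - (x j)%:P).
  by rewrite /w (bigD1 i).
rewrite -[X in presidue X _]mul1r presidue_mul2r ?monicXsubC //.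
  by rewrite presidue_XsubC hornerC mulr1.
by apply: monic_prod_XsubC.
Qed.

End Residue.

(** * Knot insertion and touching polynomials *)

Section Knots.
Variable R : realFieldType.
Implicit Types (N P q : {poly R}) (D S : seq R) (x y z e : R).

Definition divdiff3 P x y z := presidue P (('X - x%:P) * ('X - y%:P) * ('X - z%:P)).

(** In the Lagrange basis [W i] of the nodes, q^2 is a double sum of [W i * W j]. Cancelling these
    against the squared product leaves the denominator (X - d_i)(X - d_j)(X - e), so the residue is
    the given quadratic form at the Lagrange coefficients [c i] of [q]. *)
Lemma presidue_double_nodes (k : nat) (d : 'I_k -> R) e P q : injective d ->
    (size q <= k)%N ->
    (forall w : 'I_k -> R,
       0 <= \sum_i \sum_j w i * w j * divdiff3 P (d i) (d j) e) ->
  0 <= presidue (P * q ^+ 2) ((\prod_i ('X - (d i)%:P)) ^+ 2 * ('X - e%:P)).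
Proof.
move=> dI sq Kpsd; rewrite (lagrange_decomp dI sq).
pose c i := q.[d i] / \prod_(j | j != i) (d i - d j).
pose W i := \prod_(j | j != i) ('X - (d j)%:P).
rewrite -/(\sum_i c i *: W i).
rewrite expr2 big_distrlr /= mulr_sumr presidue_sum.
rewrite [leRHS](_ : _ = \sum_i \sum_j c i * c j * divdiff3 P (d i) (d j) e) //.
apply: eq_bigr => i _; rewrite mulr_sumr presidue_sum; apply: eq_bigr => j _.
have -> : P * (c i *: W i * (c j *: W j)) = (c i * c j) *: (P * (W i * W j)).
  by rewrite -!mul_polyC polyCM; ring.
rewrite presidueZ; congr (_ * _).
have E l : \prod_i ('X - (d i)%:P) = W l * ('X - (d l)%:P).
  by rewrite (bigD1 l) //= mulrC.
rewrite expr2 {1}(E i) (E j).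
have -> : W i * ('X - (d i)%:P) * (W j * ('X - (d j)%:P)) * ('X - e%:P) =
  ('X - (d i)%:P) * ('X - (d j)%:P) * ('X - e%:P) * (W i * W j) by ring.
by rewrite presidue_mul2r // !rpredM ?monicXsubC ?monic_prod_XsubC.
Qed.

(* For [x < y < z] the function [1 / ((t - x)(t - y)(t - z))] is a convex combination of
   [1 / ((t - x)(t - y)^2)] and [1 / ((t - y)^2 (t - z))]. *)
Lemma presidue_knots_sorted N (T : pred R) (k : nat) :
    (forall D e, uniq (e :: D) -> all T (e :: D) -> size D = k ->
       0 <= presidue N (\prod_(d <- D) ('X - d%:P) ^+ 2 * ('X - e%:P))) ->
  forall (j : nat) D S, sorted <%R S -> uniq (S ++ D) -> all T (S ++ D) ->
    size S = j.*2.+1 -> (size D + j)%N = k ->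
    0 <= presidue N (\prod_(d <- D) ('X - d%:P) ^+ 2 * \prod_(s <- S) ('X - s%:P)).
Proof.
move=> base; elim=> [|j IH] D S sS uSD aSD szS szD.
  case: S szS sS uSD aSD => [//|e [|//]] _ _ uSD aSD.
  by rewrite big_seq1; apply: base => //; rewrite -szD addn0.
case: S szS sS uSD aSD => [//|x [//|y [//|z S]]] [szS] sS uSD aSD.
have [xy yz] : x < y /\ y < z by move: sS => /= /and3P[].
have zx : 0 < z - x by rewrite subr_gt0 (lt_trans xy).
set A := \prod_(d <- D) _; set B := \prod_(s <- S) ('X - s%:P).
have Am : A \is monic by rewrite monic_prod // => i _; rewrite rpredX ?monicXsubC.
have Bm : B \is monic by rewrite monic_prod_XsubC.
have swap u : perm_eq ((u :: S) ++ y :: D) (u :: y :: S ++ D).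
  by rewrite /= perm_cons; exact: permEl (perm_catCA S [:: y] D).
(* Both uses of the induction hypothesis: [y] becomes a double node, and of its neighbours [x] and
   [z] only [u] is kept. *)
have IHu u : subseq (u :: S) (x :: y :: z :: S) ->
    subseq (u :: y :: S ++ D) (x :: y :: z :: S ++ D)
      || subseq (y :: u :: S ++ D) (x :: y :: z :: S ++ D) ->
    0 <= presidue N (\prod_(d <- y :: D) ('X - d%:P) ^+ 2
                      * \prod_(s <- u :: S) ('X - s%:P)).
  move=> sub1 sub2.
  have [s2 subs2 perm2] : exists2 s2, subseq s2 (x :: y :: z :: S ++ D)
      & perm_eq ((u :: S) ++ y :: D) s2.
    case/orP: sub2 => sub2; [exists (u :: y :: S ++ D)|exists (y :: u :: S ++ D)] => //.
    by apply: perm_trans (swap u) _; exact: permEl (perm_catCA [:: u] [:: y] (S ++ D)).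
  apply: IH.
  - by apply: subseq_sorted sub1 sS; exact: lt_trans.
  - by rewrite (perm_uniq perm2); apply: subseq_uniq subs2 uSD.
  - rewrite (perm_all _ perm2); apply/allP => v /(mem_subseq subs2) vs.
    by move/allP: aSD; apply.
  - by rewrite /= szS.
  - by rewrite -szD /= addSnnS.
have Hx : 0 <= presidue N (\prod_(d <- y :: D) ('X - d%:P) ^+ 2
              * \prod_(s <- x :: S) ('X - s%:P)).
  apply: IHu; first exact: (cat_subseq (subseq_refl [:: x]) (suffix_subseq [:: y; z] S)).
  by rewrite (cat_subseq (subseq_refl [:: x; y]) (subseq_cons (S ++ D) z)).
have Hz : 0 <= presidue N (\prod_(d <- y :: D) ('X - d%:P) ^+ 2
              * \prod_(s <- z :: S) ('X - s%:P)).
  apply: IHu; first exact: (suffix_subseq [:: x; y]).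
  by rewrite (suffix_subseq [:: x] (y :: z :: S ++ D)) orbT.
rewrite !big_cons -/A -/B in Hx Hz *.
(* The weight with y = t z + (1 - t) x. Numerator and denominator are multiplied by X - y, and the
   numerator is then split according to this combination. *)
pose t := (y - x) / (z - x).
have t0 : 0 <= t by rewrite divr_ge0 ?ltW // subr_gt0.
have t1 : 0 <= 1 - t.
  by rewrite subr_ge0 ler_pdivrMr // mul1r lerD2r ltW.
have yE : 'X - y%:P = t *: ('X - z%:P) + (1 - t) *: ('X - x%:P).
  have {1}-> : y = t * z + (1 - t) * x by rewrite /t; field; rewrite gt_eqF.
  by rewrite -!mul_polyC !(polyCD, polyCM, polyCN, polyC1); ring.
rewrite -(@presidue_mul2r _ _ _ ('X - y%:P)) ?rpredM ?monicXsubC //.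
rewrite {1}yE mulrDr -!scalerAr presidueD !presidueZ.
apply: addr_ge0; apply: mulr_ge0 => //.
- rewrite (_ : _ * ('X - y%:P) =
    (('X - y%:P) ^+ 2 * A * (('X - x%:P) * B)) * ('X - z%:P)); last by ring.
  by rewrite presidue_mul2r ?rpredM ?rpredX ?monicXsubC.
- rewrite (_ : _ * ('X - y%:P) =
    (('X - y%:P) ^+ 2 * A * (('X - z%:P) * B)) * ('X - x%:P)); last by ring.
  by rewrite presidue_mul2r ?rpredM ?rpredX ?monicXsubC.
Qed.

(** Knot insertion started with no double node; sorting only permutes the factors of the product. *)
Lemma presidue_knots N (T : pred R) (k : nat) :
    (forall D e, uniq (e :: D) -> all T (e :: D) -> size D = k ->
       0 <= presidue N (\prod_(d <- D) ('X - d%:P) ^+ 2 * ('X - e%:P))) ->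
  forall S, uniq S -> all T S -> size S = k.*2.+1 ->
    0 <= presidue N (\prod_(s <- S) ('X - s%:P)).
Proof.
move=> base S uS aS szS.
have pS : perm_eq (sort <=%R S) S by rewrite perm_sort.
rewrite -(perm_big _ pS) /=.
have := presidue_knots_sorted base (j := k) (D := [::]) (S := sort <=%R S).
rewrite big_nil mul1r cats0; apply.
- by rewrite sort_lt_sorted.
- by rewrite sort_uniq.
- by rewrite (perm_all _ pS).
- by rewrite size_sort.
- by [].
Qed.

(* If [f <= P] touches at the roots of [u], [f <= p] touches at [d], and
   [alpha u + beta w = 1] with [w = (X - d)^2], then [H = P beta w + p alpha u] agrees with [P]
   modulo [u] and with [p] modulo [w], so that [f - H] is bounded by multiples of
   both [u] and [w], hence of [u w] by the Bezout relation. *)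
Lemma touching_polynomial (f : R -> R) (a b : R) (s : seq R) : uniq s ->
    (forall d, d \in s -> exists2 p : {poly R}, p.[d] = f d
        & forall x, a <= x <= b -> f x <= p.[x]) ->
    (exists p : {poly R}, forall x, a <= x <= b -> f x <= p.[x]) ->
  exists2 P : {poly R}, (forall d, d \in s -> P.[d] = f d)
    & forall x, a <= x <= b -> f x <= P.[x].
Proof.
move=> + + [p0 fp0]; elim: s => [|d s IH]; first by exists p0.
move=> /= /andP[ds us] touch.
have [|P Ps fP] := IH us.
  by move=> y ys; apply: touch; rewrite inE ys orbT.
have [p pd fp] := touch d (mem_head _ _).
pose u := \prod_(y <- s) ('X - y%:P) ^+ 2; pose w := ('X - d%:P) ^+ 2.
have u0 x : 0 <= u.[x].
  by rewrite horner_prod; apply: prodr_ge0 => y _; rewrite horner_exp sqr_ge0.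
have w0 x : 0 <= w.[x] by rewrite horner_exp sqr_ge0.
have us0 y : y \in s -> u.[y] = 0.
  move=> ys; rewrite horner_prod (big_rem y) //= horner_exp hornerXsubC.
  by rewrite subrr expr0n mul0r.
have wd0 : w.[d] = 0 by rewrite horner_exp hornerXsubC subrr expr0n.
have [[al be] /= bez] : exists v : {poly R} * {poly R}, v.1 * u + v.2 * w = 1.
  apply/Bezout_eq1_coprimepP; rewrite coprimep_expr // coprimep_XsubC rootE.
  rewrite horner_prod prodf_seq_neq0; apply/allP => y ys /=.
  rewrite horner_exp hornerXsubC expf_neq0 // subr_eq0.
  by apply: contraNneq ds => ->.
have bezx x : al.[x] * u.[x] + be.[x] * w.[x] = 1.
  by rewrite -!hornerM -hornerD bez hornerC.
clearbody u w.
pose H := P * be * w + p * al * u.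
have [K1 K1P] := poly_itv_bound ((P - p) * al) a b.
have [K2 K2P] := poly_itv_bound ((p - P) * be) a b.
have [A AP] := poly_itv_bound al a b.
have [B BP] := poly_itv_bound be a b.
(* With h = f - H, the bounds h <= K1 u and h <= K2 w together with h = al (h u) + be (h w) give h
   <= (A K2 + B K1) u w wherever h >= 0; where h < 0 the added term is nonnegative anyway. *)
exists (H + (A * K2 + B * K1) *: (u * w)).
  move=> y; rewrite inE hornerD hornerZ hornerM => /predU1P[->|ys].
    rewrite wd0 !mulr0 addr0 /H hornerD !hornerM wd0 mulr0 add0r.
    by rewrite -mulrA pd; have := bezx d; rewrite wd0 mulr0 addr0 => ->; rewrite mulr1.
  rewrite us0 // mul0r mulr0 addr0 /H hornerD !hornerM us0 // mulr0 addr0.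
  by rewrite -mulrA Ps //; have := bezx y; rewrite us0 // mulr0 add0r => ->; rewrite mulr1.
move=> x xab; rewrite hornerD hornerZ hornerM -lerBlDl.
have := fP _ xab; have := fp _ xab.
have := K1P _ xab; have := K2P _ xab; have := AP _ xab; have := BP _ xab.
have := u0 x; have := w0 x; have := bezx x.
rewrite /H !(hornerD, hornerN, hornerM).
move: (f x) (P.[x]) (p.[x]) (u.[x]) (w.[x]) (al.[x]) (be.[x]) => F P' p' U W al' be' bz W0 U0.
rewrite !ler_norml => /andP[B1 B2] /andP[A1 A2] /andP[K21 K22] /andP[K11 K12] fp' fP'.
set h := F - _.
have h1 : h <= K1 * U.
  apply: (@le_trans _ _ ((P' - p') * al' * U)); last by rewrite ler_wpM2r.
  rewrite /h lerBlDr (le_trans fP') //.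
  rewrite [leRHS](_ : _ = P' * (al' * U + be' * W)); last by ring.
  by rewrite bz mulr1.
have h2 : h <= K2 * W.
  apply: (@le_trans _ _ ((p' - P') * be' * W)); last by rewrite ler_wpM2r.
  rewrite /h lerBlDr (le_trans fp') //.
  rewrite [leRHS](_ : _ = p' * (al' * U + be' * W)); last by ring.
  by rewrite bz mulr1.
have [h0|/ltW h0] := lerP h 0.
  apply: (le_trans h0); rewrite !mulr_ge0 // addr_ge0 // mulr_ge0 //; lra.
have -> : h = al' * (h * U) + be' * (h * W) by rewrite -[LHS]mulr1 -bz; ring.
have hU : h * U <= K2 * W * U by rewrite ler_wpM2r.
have hW : h * W <= K1 * U * W by rewrite ler_wpM2r.
have hU0 : 0 <= h * U by rewrite mulr_ge0.
have hW0 : 0 <= h * W by rewrite mulr_ge0.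
apply: (@le_trans _ _ (A * (h * U) + B * (h * W))).
  by apply: lerD; rewrite ler_wpM2r.
rewrite [leRHS](_ : _ = A * (K2 * W * U) + B * (K1 * U * W)); last by ring.
by apply: lerD; apply: ler_wpM2l => //; lra.
Qed.

End Knots.

(** * Functional calculus of Hermitian matrices *)

Local Open Scope sesquilinear_scope.
Local Open Scope complex_scope.

Local Notation conjC := Num.conj.
Section FunCalc.
Variable R : realType.
Local Notation C := R[i].

Definition sqnormc (z : C) : R := complex.Re z ^+ 2 + complex.Im z ^+ 2.

Lemma sqnormc_ge0 z : 0 <= sqnormc z.
Proof. by rewrite addr_ge0 ?sqr_ge0. Qed.

Lemma conjCc (z : C) : conjC z = conjc z.
Proof. by []. Qed.

Lemma conj_real (x : R) : conjC x%:C = x%:C.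
Proof. by rewrite conjCc /= oppr0. Qed.

Lemma mulcJ (z : C) : conjC z * z = (sqnormc z)%:C.
Proof.
case: z => a b; rewrite conjCc /=; apply/eqP; rewrite eq_complex /=.
by apply/andP; split; apply/eqP; rewrite /sqnormc /=; ring.
Qed.

Definition quad n (M : 'M[C]_n) (v : 'cV[C]_n) : C := (v ^t* *m M *m v) 0 0.

Lemma quadD n (M N : 'M[C]_n) v : quad (M + N) v = quad M v + quad N v.
Proof. by rewrite /quad mulmxDr mulmxDl mxE. Qed.

Lemma quadN n (M : 'M[C]_n) v : quad (- M) v = - quad M v.
Proof. by rewrite /quad mulmxN mulNmx mxE. Qed.

Lemma quadB n (M N : 'M[C]_n) v : quad (M - N) v = quad M v - quad N v.
Proof. by rewrite quadD quadN. Qed.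

Lemma quadZ n c (M : 'M[C]_n) v : quad (c *: M) v = c * quad M v.
Proof. by rewrite /quad -scalemxAr -scalemxAl mxE. Qed.

Lemma quadE n (M : 'M[C]_n) v :
  quad M v = \sum_i \sum_j conjC (v i 0) * M i j * v j 0.
Proof.
rewrite /quad mxE exchange_big /=; apply: eq_bigr => j _.
by rewrite mxE mulr_suml; apply: eq_bigr => i _; rewrite !mxE.
Qed.

Lemma hermsymmxP n (A : 'M[C]_n) : reflect (A = A ^t*) (A \is hermsymmx).
Proof.
by apply: (iffP (is_hermitianmxP _ _ _)); rewrite expr0 scale1r.
Qed.

Lemma hermsymmxD n (A B : 'M[C]_n) :
  A \is hermsymmx -> B \is hermsymmx -> A + B \is hermsymmx.
Proof.
move=> /hermsymmxP hA /hermsymmxP hB; apply/hermsymmxP.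
by rewrite linearD /= map_mxD -hA -hB.
Qed.

Lemma hermsymmxN n (A : 'M[C]_n) : A \is hermsymmx -> - A \is hermsymmx.
Proof.
by move=> /hermsymmxP hA; apply/hermsymmxP; rewrite linearN /= map_mxN -hA.
Qed.

Lemma hermsymmxB n (A B : 'M[C]_n) :
  A \is hermsymmx -> B \is hermsymmx -> A - B \is hermsymmx.
Proof. by move=> hA hB; rewrite hermsymmxD ?hermsymmxN. Qed.

Lemma hermsymmxZ n (l : R) (A : 'M[C]_n) :
  A \is hermsymmx -> l%:C *: A \is hermsymmx.
Proof.
move=> /hermsymmxP hA; apply/hermsymmxP.
rewrite linearZ /= map_mxZ -hA; congr (_ *: _).
exact/esym/conj_real.
Qed.

Definition eigval n (A : 'M[C]_n) (i : 'I_n) : R := complex.Re (spectral_diag A 0 i).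

(** The weight that the spectral measure of [A] at the vector [v] gives to the i-th eigenvector. *)
Definition mass n (A : 'M[C]_n) (v : 'cV[C]_n) (i : 'I_n) : R :=
  sqnormc ((spectralmx A *m v) i 0).

Lemma mass_ge0 n (A : 'M[C]_n) v i : 0 <= mass A v i.
Proof. exact: sqnormc_ge0. Qed.

Lemma spectral_diagE n (A : 'M[C]_n) i :
  A \is hermsymmx -> spectral_diag A 0 i = (eigval A i)%:C.
Proof.
move=> /hermitian_spectral_diag_real /mxOverP /(_ 0 i) /CrealP.
rewrite /eigval; case: (spectral_diag A 0 i) => a b /eqP.
rewrite conjCc eq_complex /= eqxx /= -subr_eq0 -opprD oppr_eq0 => /eqP b0.
by have -> : b = 0 by lra.
Qed.

(** The coefficients depend on the index and not on the eigenvalue, so that a spectral sum can be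
    truncated even inside a multiple eigenvalue. *)
Definition specmx n (A : 'M[C]_n) (c : 'I_n -> R) : 'M[C]_n :=
  (spectralmx A)^t* *m diag_mx (\row_i (c i)%:C) *m spectralmx A.

Lemma fun_calcE n (f : R -> R) (A : 'M[C]_n) :
  fun_calc f A = specmx A (fun i => f (eigval A i)).
Proof.
rewrite /fun_calc (invmx_unitary (spectral_unitarymx A)).
have -> // : map_mx (fun z : C => (f (complex.Re z))%:C) (spectral_diag A)
  = \row_i (f (eigval A i))%:C.
by apply/rowP => i; rewrite !mxE.
Qed.

Lemma fun_calc_id n (A : 'M[C]_n) : A \is hermsymmx -> fun_calc id A = A.
Proof.
move=> hA; have /hermitian_normalmx/orthomx_spectralP AE := hA.
rewrite [RHS]AE /fun_calc.
have -> // : map_mx (fun z : C => (complex.Re z)%:C) (spectral_diag A) = spectral_diag A.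
by apply/rowP => i; rewrite !mxE spectral_diagE.
Qed.

Lemma quad_specmx n (A : 'M[C]_n) c v :
  quad (specmx A c) v = (\sum_i mass A v i * c i)%:C.
Proof.
rewrite /specmx /quad !mulmxA -mulmxA -map_mxM -trmx_mul.
rewrite mxE rmorph_sum; apply: eq_bigr => i _.
rewrite mul_mx_diag !mxE rmorphM /= /mass -mulcJ mxE.
set x := \sum_j _; rewrite mulrAC; congr (_ * _ * _).
Qed.

Lemma quad_fun_calc n (f : R -> R) (A : 'M[C]_n) v :
  quad (fun_calc f A) v = (\sum_i mass A v i * f (eigval A i))%:C.
Proof. by rewrite fun_calcE quad_specmx. Qed.

Lemma specmx_hermsymmx n (A : 'M[C]_n) c : specmx A c \is hermsymmx.
Proof.
apply/hermsymmxP; rewrite /specmx; move: (spectralmx A) => P.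
set D := diag_mx _.
have DD : D ^t* = D.
  rewrite tr_diag_mx; apply/matrixP => i j; rewrite /D !mxE rmorphMn /=.
  exact: (congr1 (fun z => z *+ (i == j)) (conj_real _)).
by rewrite !trmx_mul !map_mxM DD trmxCK mulmxA.
Qed.

Lemma fun_calc_hermsymmx n (f : R -> R) (A : 'M[C]_n) : fun_calc f A \is hermsymmx.
Proof. by rewrite fun_calcE specmx_hermsymmx. Qed.

Lemma spectralmxKl n (A : 'M[C]_n) : spectralmx A *m (spectralmx A)^t* = 1%:M.
Proof. exact/unitarymxP/spectral_unitarymx. Qed.

Lemma spectralmxKr n (A : 'M[C]_n) : (spectralmx A)^t* *m spectralmx A = 1%:M.
Proof. exact/mulmx1C/spectralmxKl. Qed.

Lemma fun_calcM n (f g : R -> R) (A : 'M[C]_n) :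
  fun_calc (fun x => f x * g x) A = fun_calc f A *m fun_calc g A.
Proof.
rewrite !fun_calcE /specmx.
have -> : diag_mx (\row_i (f (eigval A i) * g (eigval A i))%:C)
  = diag_mx (\row_i (f (eigval A i))%:C) *m diag_mx (\row_i (g (eigval A i))%:C).
  by rewrite mul_diag_mx; apply/matrixP => i j; rewrite !mxE rmorphM /= mulrnAr.
have aux (P Q D1 D2 : 'M[C]_n) : P *m Q = 1%:M ->
    Q *m (D1 *m D2) *m P = Q *m D1 *m P *m (Q *m D2 *m P).
  by move=> PQ; rewrite !mulmxA -(mulmxA _ P Q) PQ mulmx1.
by rewrite aux // spectralmxKl.
Qed.

Lemma fun_calcD n (f g : R -> R) (A : 'M[C]_n) :
  fun_calc (fun x => f x + g x) A = fun_calc f A + fun_calc g A.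
Proof.
rewrite !fun_calcE /specmx -mulmxDl -mulmxDr -linearD /=.
have -> // : \row_i (f (eigval A i) + g (eigval A i))%:C
  = \row_i (f (eigval A i))%:C + \row_i (g (eigval A i))%:C.
by apply/rowP => i; rewrite !mxE rmorphD.
Qed.

Lemma fun_calc_cst n (c : R) (A : 'M[C]_n) : fun_calc (fun=> c) A = (c%:C)%:M.
Proof.
rewrite fun_calcE /specmx.
have -> : \row_(i < n) c%:C = const_mx c%:C by apply/rowP => i; rewrite !mxE.
by rewrite diag_const_mx mul_mx_scalar -scalemxAl spectralmxKr scalemx1.
Qed.

Lemma eq_fun_calc n (f g : R -> R) (A : 'M[C]_n) :
  (forall i, f (eigval A i) = g (eigval A i)) -> fun_calc f A = fun_calc g A.
Proof.
move=> fg; rewrite !fun_calcE /specmx.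
have -> // : \row_i (f (eigval A i))%:C = \row_i (g (eigval A i))%:C.
by apply/rowP => i; rewrite !mxE fg.
Qed.

Lemma spectral_eigen n (A : 'M[C]_n) i : A \is hermsymmx ->
  row i (spectralmx A) *m A = (eigval A i)%:C *: row i (spectralmx A).
Proof.
move=> hA; rewrite -{2}(fun_calc_id hA) fun_calcE /specmx -row_mul !mulmxA spectralmxKl mul1mx.
by rewrite row_mul row_diag_mx mxE -scalemxAl -rowE.
Qed.

Lemma eigenvalue_eigval n (A : 'M[C]_n) i : A \is hermsymmx ->
  eigenvalue A (eigval A i)%:C.
Proof.
move=> hA; apply/eigenvalueP; exists (row i (spectralmx A)); first exact: spectral_eigen.
apply/eqP => r0; have : row i (spectralmx A) *m (spectralmx A)^t* = 0.
  by rewrite r0 mul0mx.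
rewrite -row_mul spectralmxKl => /rowP /(_ i); rewrite !mxE eqxx => /eqP.
by rewrite oner_eq0.
Qed.

Lemma eigenvalue_eigvalP n (A : 'M[C]_n) z : A \is hermsymmx ->
  eigenvalue A z -> exists i, z = (eigval A i)%:C.
Proof.
move=> hA /eigenvalueP[v vA v0].
pose u := v *m (spectralmx A)^t*.
have uE : u *m diag_mx (\row_i (eigval A i)%:C) = z *: u.
  have AE := fun_calcE id A; rewrite (fun_calc_id hA) /specmx in AE.
  rewrite /u scalemxAl -vA [X in _ = v *m X *m _]AE -!mulmxA.
  by rewrite spectralmxKl mulmx1.
have /rV0Pn[i ui] : u != 0.
  apply: contraNneq v0 => u0.
  by rewrite -[v]mulmx1 -(spectralmxKr A) mulmxA -/u u0 mul0mx.
clearbody u; exists i; apply: (mulIf ui).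
by move/rowP/(_ i): uE; rewrite mul_mx_diag !mxE mulrC.
Qed.

Lemma spectrum_in_eigval n a b (A : 'M[C]_n) : A \is hermsymmx ->
  spectrum_in a b A <-> forall i, in_oo a b (eigval A i).
Proof.
move=> hA; split=> [sA i|sA z /(eigenvalue_eigvalP hA)[i ->]]; last by exists (eigval A i).
by have [x xab [->]] := sA _ (eigenvalue_eigval i hA).
Qed.

Lemma loewner_leE n (A B : 'M[C]_n) : A \is hermsymmx -> B \is hermsymmx ->
  loewner_le A B <-> forall v, quad A v <= quad B v.
Proof.
move=> hA hB; split=> [[_ AB] v|AB]; first by have := AB v; rewrite -/(quad _ _) quadB subr_ge0.
by split=> [|v]; [exact: hermsymmxB | rewrite -/(quad _ _) quadB subr_ge0].
Qed.

Lemma quad_eigval n (A : 'M[C]_n) v : A \is hermsymmx ->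
  quad A v = (\sum_i mass A v i * eigval A i)%:C.
Proof. by move=> hA; rewrite -{1}(fun_calc_id hA) quad_fun_calc. Qed.

Definition sqnorm n (v : 'cV[C]_n) : R := \sum_i sqnormc (v i 0).

Lemma sqnormE n (v : 'cV[C]_n) : (v^t* *m v) 0 0 = (sqnorm v)%:C.
Proof.
rewrite mxE /sqnorm rmorph_sum; apply: eq_bigr => i _.
by rewrite !mxE mulcJ.
Qed.

Lemma sum_mass n (A : 'M[C]_n) v : \sum_i mass A v i = sqnorm v.
Proof.
apply: (@complexI R); rewrite -sqnormE -/(sqnorm (spectralmx A *m v)) -sqnormE.
by rewrite trmx_mul map_mxM mulmxA -[X in X *m v]mulmxA spectralmxKr mulmx1.
Qed.

Definition eigvec n (A : 'M[C]_n) i : 'cV[C]_n := (spectralmx A)^t* *m delta_mx i 0.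

Lemma mass_eigvec n (A : 'M[C]_n) i j : mass A (eigvec A i) j = (j == i)%:R.
Proof.
rewrite /mass /eigvec mulmxA spectralmxKl mul1mx mxE eqxx andbT /sqnormc.
by case: (j == i) => /=; rewrite ?expr1n expr0n /= ?addr0.
Qed.

Lemma quad_eigvec n (A : 'M[C]_n) i : A \is hermsymmx ->
  quad A (eigvec A i) = (eigval A i)%:C.
Proof.
move=> hA; rewrite quad_eigval // (bigD1 i) //= big1 => [|j ji].
  by rewrite mass_eigvec eqxx mul1r addr0.
by rewrite mass_eigvec (negbTE ji) mul0r.
Qed.

Lemma sqnorm_eigvec n (A : 'M[C]_n) i : sqnorm (eigvec A i) = 1.
Proof.
rewrite -(sum_mass A) (bigD1 i) //= big1 => [|j ji]; rewrite mass_eigvec ?eqxx ?addr0 //.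
by rewrite (negbTE ji).
Qed.

(** Test at a unit eigenvector of [M]: its eigenvalue lies between the quadratic forms of [A] and
    [B], which are averages of their eigenvalues weighted by [mass]. *)
Lemma eigval_between n (A M B : 'M[C]_n) (l h : R) :
    A \is hermsymmx -> M \is hermsymmx -> B \is hermsymmx ->
    (forall v, quad A v <= quad M v) -> (forall v, quad M v <= quad B v) ->
    (forall i, l <= eigval A i) -> (forall i, eigval B i <= h) ->
  forall i, l <= eigval M i <= h.
Proof.
move=> hA hM hB AM MB lA Bh i.
have := AM (eigvec M i); have := MB (eigvec M i).
rewrite quad_eigvec // !quad_eigval // !lecR => MB' AM'; apply/andP; split.
  apply: le_trans AM'; rewrite -[l]mulr1 -(sqnorm_eigvec M i) -(sum_mass A) mulr_sumr.
  by apply: ler_sum => j _; rewrite mulrC ler_wpM2l ?mass_ge0.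
apply: (le_trans MB'); rewrite -[h]mulr1 -(sqnorm_eigvec M i) -(sum_mass B) mulr_sumr.
by apply: ler_sum => j _; rewrite [leRHS]mulrC ler_wpM2l ?mass_ge0.
Qed.

End FunCalc.

(** * Kraus' inequality *)

Local Open Scope classical_set_scope.

Definition divdiff2 (R : realFieldType) (P : {poly R}) x y :=
  presidue P (('X - x%:P) * ('X - y%:P)).

(** * Recursions for divided differences of first and second order, and Gershgorin's bound *)

Section SmallDividedDifferences.
Variable R : realFieldType.
Implicit Types (P : {poly R}) (x y z c : R).

Let monic2 x y : ('X - x%:P) * ('X - y%:P) \is monic.
Proof. by rewrite rpredM ?monicXsubC. Qed.

(** Horner step, from P X = x P + (X - x) P; the constant contributes nothing. With [divdiff3_cons]
    this reproduces the recursion that defines [pert]. *)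
Lemma divdiff2_cons P c x y :
  divdiff2 (P * 'X + c%:P) x y = x * divdiff2 P x y + P.[y].
Proof.
rewrite /divdiff2.
have -> : P * 'X + c%:P = x *: P + ('X - x%:P) * P + c%:P.
  by rewrite -mul_polyC; ring.
rewrite 2!presidueD presidueZ presidue_mul2l ?monicXsubC // presidue_XsubC.
rewrite [X in _ + X]presidue_small ?addr0 // size_monicM ?monicXsubC ?polyXsubC_eq0 //.
by rewrite !size_XsubC ltnS ltnS size_polyC_leq1.
Qed.

Lemma divdiff3_cons P c x y z :
  divdiff3 (P * 'X + c%:P) x y z = x * divdiff3 P x y z + divdiff2 P y z.
Proof.
rewrite /divdiff3.
have -> : P * 'X + c%:P = x *: P + ('X - x%:P) * P + c%:P.
  by rewrite -mul_polyC; ring.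
rewrite 2!presidueD presidueZ -mulrA presidue_mul2l ?monicXsubC //.
rewrite [X in _ + X]presidue_small ?addr0 //.
rewrite size_monicM ?monicXsubC ?monic_neq0 // size_monicM ?monicXsubC ?polyXsubC_eq0 //.
by rewrite !size_XsubC size_polyC; case: (c == 0).
Qed.

(** The usual recurrence for divided differences, written without division so that it covers
    coinciding nodes. *)
Lemma divdiff3_rec P x y z :
  divdiff2 P x z + (y - x) * divdiff3 P x y z = divdiff2 P y z.
Proof.
rewrite {1}/divdiff2 -(@presidue_mul2r _ P _ ('X - y%:P)) ?monicXsubC //.
rewrite /divdiff3 mulrAC -presidueZ -presidueD.
have -> : P * ('X - y%:P) + (y - x) *: P = ('X - x%:P) * P.
  by rewrite -mul_polyC polyCB; ring.
by rewrite -mulrA presidue_mul2l ?monicXsubC.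
Qed.

Lemma divdiff3C P x y z : divdiff3 P x y z = divdiff3 P x z y.
Proof. by rewrite /divdiff3 mulrAC. Qed.

(** In the equation of a left eigenvector [r], look at the coordinate where |r_i| is largest: the
    deviation of [M] from the diagonal contributes at most n eta |r_i|. *)
Lemma gershgorin n (M : 'I_n -> 'I_n -> R) (c r : 'I_n -> R) (l eta : R) :
    (exists i, r i != 0) -> (forall i, \sum_j r j * M j i = l * r i) ->
    (forall i j, `|M i j - (i == j)%:R * c i| <= eta) ->
  exists i, `|l - c i| <= n%:R * eta.
Proof.
move=> [i0 ri0] rM Mc.
have [i _ imax] := @arg_maxP _ _ _ i0 xpredT (fun i => `|r i|) isT.
have ri : 0 < `|r i| by apply: lt_le_trans (imax i0 isT); rewrite normr_gt0.
exists i; rewrite -(ler_pM2r ri) -normrM mulrBl -rM.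
have -> : c i * r i = \sum_j r j * ((j == i)%:R * c j).
  rewrite (bigD1 i) //= eqxx mul1r big1 ?addr0 1?mulrC // => j /negbTE ->.
  by rewrite mul0r mulr0.
rewrite -sumrB; apply: le_trans (ler_norm_sum _ _ _) _.
rewrite -mulrA mulr_natl -[n in _ *+ n]card_ord -sumr_const; apply: ler_sum => j _.
rewrite -mulrBr normrM mulrC ler_pM //; exact: imax.
Qed.
End SmallDividedDifferences.

(** * Eigenvalues and polynomials of diagonal matrices with a rank-one perturbation *)

Section Perturbation.
Variable R : realType.
Local Notation C := R[i].

(* For [P] with coefficients [s], the entries of [P(diag d + kappa tau tau^T)] are
   [(i == j) P(d i) + kappa (tau i) (tau j) (pert s i j)], where [t = tau^2]. *)
Fixpoint pert n (d t : 'I_n -> R) (kappa : R) (s : seq R) (i j : 'I_n) : R :=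
  if s is _ :: s' then
    d i * pert d t kappa s' i j + kappa * \sum_k t k * pert d t kappa s' k j
      + (Poly s').[d j]
  else 0.

(** The matrix and the eigenvalue are real while the eigenvector is complex; its real or its
    imaginary part is a nonzero real eigenvector, to which [gershgorin] applies. *)
Lemma eigval_near n (A : 'M[C]_n) (M : 'I_n -> 'I_n -> R) c eta k :
    A \is hermsymmx -> (forall i j, A i j = (M i j)%:C) ->
    (forall i j, `|M i j - (i == j)%:R * c i| <= eta) ->
  exists i, `|eigval A k - c i| <= n%:R * eta.
Proof.
move=> hA AM Mc; have /eigenvalueP[v vA /rV0Pn[i0 vi0]] := eigenvalue_eigval k hA.
have vAi i : \sum_j v 0 j * (M j i)%:C = (eigval A k)%:C * v 0 i.
  by have /rowP/(_ i) := vA; rewrite !mxE => <-; apply: eq_bigr => j _; rewrite AM.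
have real_part (g : C -> R) : g 0 = 0 -> {morph g : x y / x + y} ->
    (forall z x, g (z * x%:C) = g z * x) -> g (v 0 i0) != 0 ->
    exists i, `|eigval A k - c i| <= n%:R * eta.
  move=> g0 gD gM r0; apply: (gershgorin (r := fun i => g (v 0 i))) Mc; first by exists i0.
  move=> i; have := congr1 g (vAi i); rewrite mulrC gM [RHS]mulrC => <-.
  by rewrite (big_morph g gD g0); apply: eq_bigr => j _; rewrite gM.
have [Im0|Im_neq0] := eqVneq (complex.Im (v 0 i0)) 0; last first.
  apply: real_part Im_neq0 => [//|[? ?] [? ?] //|[x y] z /=].
  by rewrite mulr0 add0r.
have Re_neq0 : complex.Re (v 0 i0) != 0.
  by apply: contraNneq vi0 => Re0; rewrite eq_complex Re0 Im0 !eqxx.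
apply: real_part Re_neq0 => [//|[? ?] [? ?] //|[x y] z /=].
by rewrite mulr0 subr0.
Qed.

Lemma sum_kronecker n (i : 'I_n) (F : 'I_n -> R) : \sum_k (i == k)%:R * F k = F i.
Proof.
rewrite (bigD1 i) //= eqxx mul1r big1 ?addr0 // => k.
by rewrite eq_sym => /negbTE->; rewrite mul0r.
Qed.

(** Induction along Horner's scheme. In A P(A) + c the factor tau_i tau_j splits off the perturbed
    part, and the product of the two rank-one parts leaves the sum over tau_k^2 that occurs in
    [pert]. *)
Lemma fun_calc_pert n (A : 'M[C]_n) (d tau : 'I_n -> R) kappa s i j :
    A \is hermsymmx ->
    (forall i j, A i j = ((i == j)%:R * d i + kappa * tau i * tau j)%:C) ->
  fun_calc (horner (Poly s)) A i j = ((i == j)%:R * (Poly s).[d i]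
     + kappa * tau i * tau j * pert d (fun k => tau k ^+ 2) kappa s i j)%:C.
Proof.
move=> hA AE; elim: s i j => [|c s IH] i j.
  rewrite (@eq_fun_calc _ _ _ (fun=> 0)) => [|k]; last by rewrite horner0.
  by rewrite fun_calc_cst mxE /= horner0 mul0rn !mulr0 addr0.
rewrite (@eq_fun_calc _ _ _ (fun x => x * (Poly s).[x] + c)); last first.
  by move=> k; rewrite /= cons_poly_def hornerD hornerMX hornerC mulrC.
rewrite fun_calcD fun_calcM fun_calc_id // fun_calc_cst !mxE.
under eq_bigr => k _ do rewrite AE IH -rmorphM /=.
rewrite -rmorph_sum /= -rmorphMn -rmorphD /=; congr (_%:C).
set P := Poly s; set W := pert _ _ _ _.
have -> : \sum_k ((i == k)%:R * d i + kappa * tau i * tau k) *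
    ((k == j)%:R * P.[d k] + kappa * tau k * tau j * W k j) =
  \sum_k (i == k)%:R * (d i * ((k == j)%:R * P.[d k] + kappa * tau k * tau j * W k j))
  + \sum_k (j == k)%:R * (kappa * tau i * tau k * P.[d k])
  + kappa * tau i * tau j * (kappa * \sum_k tau k ^+ 2 * W k j).
  rewrite !mulr_sumr -!big_split /=; apply: eq_bigr => k _.
  by rewrite (eq_sym j k); ring.
rewrite !sum_kronecker cons_poly_def hornerD hornerMX hornerC -mulr_natr.
case: eqVneq => [->|_]; ring.
Qed.

(** The limit eps = 0, where the perturbation replaces the diagonal entry d_o by e. Both sides obey
    the same Horner recursion: the sum over k reduces to k = o, and [divdiff3_rec] turns that term
    into the divided difference of P at e and d_j. *)
Lemma pert_limit n (d : 'I_n -> R) (o : 'I_n) e s i j :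
  pert d (fun k => (k == o)%:R) (e - d o) s i j =
  divdiff2 (Poly s) (d i) (d j) + (e - d o) * divdiff3 (Poly s) (d i) e (d j).
Proof.
elim: s i j => [|c s IH] i j; first by rewrite /divdiff2 /divdiff3 !presidue0 mulr0 addr0.
rewrite /= cons_poly_def divdiff2_cons divdiff3_cons (bigD1 o) //= eqxx mul1r.
rewrite big1 => [|k /negbTE->]; last by rewrite mul0r.
rewrite addr0 !IH divdiff3_rec; ring.
Qed.

Lemma pert_limit0 n (d t : 'I_n -> R) s i j :
  pert d t 0 s i j = divdiff2 (Poly s) (d i) (d j).
Proof.
elim: s i j => [|c s IH] i j; first by rewrite /divdiff2 !presidue0.
by rewrite /= cons_poly_def divdiff2_cons mul0r addr0 IH.
Qed.

Lemma cvg_sum_ord (T : Type) (Fl : set_system T) {FF : Filter Fl} n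
    (F : 'I_n -> T -> R) (l : 'I_n -> R) :
  (forall i, F i x @[x --> Fl] --> l i) ->
  (\sum_i F i x) @[x --> Fl] --> \sum_i l i.
Proof.
move=> Fl_cvg; elim: (index_enum _) => [|i s IH].
  under eq_fun do rewrite big_nil.
  by rewrite big_nil; exact: cvg_cst.
under eq_fun do rewrite big_cons.
by rewrite big_cons; exact: cvgD.
Qed.

Lemma cvg_pert (T : Type) (Fl : set_system T) {FF : Filter Fl} n (d : 'I_n -> R)
    (t : T -> 'I_n -> R) (kappa : T -> R) t0 kappa0 s i j :
  (forall k, t x k @[x --> Fl] --> t0 k) -> kappa x @[x --> Fl] --> kappa0 ->
  pert d (t x) (kappa x) s i j @[x --> Fl] --> pert d t0 kappa0 s i j.
Proof.
move=> tc kc; elim: s i j => [|c s IH] i j /=; first exact: cvg_cst.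
apply: cvgD; last exact: cvg_cst.
apply: cvgD; first by apply: cvgM; [exact: cvg_cst | exact: IH].
apply: cvgM; first exact: kc.
by apply: cvg_sum_ord => k; apply: cvgM; [exact: tc | exact: IH].
Qed.

End Perturbation.

(** * Convexity along a rank-one direction and passage to the limit *)

Section Kraus.
Variable R : realType.
Local Notation C := R[i].

Lemma quad_real n (M : 'M[C]_n) (m : 'I_n -> 'I_n -> R) (v : 'I_n -> R) :
    (forall i j, M i j = (m i j)%:C) ->
  quad M (\col_i (v i)%:C) = (\sum_i \sum_j v i * m i j * v j)%:C.
Proof.
move=> ME; rewrite quadE rmorph_sum; apply: eq_bigr => i _.
rewrite rmorph_sum; apply: eq_bigr => j _.
by rewrite !mxE ME conj_real -!rmorphM.
Qed.

Lemma quad_lin2 n (x y : C) (X Y : 'M[C]_n) v :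
  quad (x *: X + y *: Y) v = x * quad X v + y * quad Y v.
Proof. by rewrite quadD !quadZ. Qed.

Lemma quad_fun_calc_le n (f g : R -> R) (M : 'M[C]_n) v :
  (forall i, f (eigval M i) <= g (eigval M i)) ->
  quad (fun_calc f M) v <= quad (fun_calc g M) v.
Proof.
move=> fg; rewrite [X in X <= _]quad_fun_calc [X in _ <= X]quad_fun_calc lecR.
by apply: ler_sum => i _; rewrite ler_wpM2l ?mass_ge0.
Qed.

Definition rank1_pert n (d tau : 'I_n -> R) kappa : 'M[C]_n :=
  \matrix_(i, j) ((i == j)%:R * d i + kappa * tau i * tau j)%:C.

Lemma rank1_pert_hermsymmx n (d tau : 'I_n -> R) kappa :
  rank1_pert d tau kappa \is hermsymmx.
Proof.
apply/hermsymmxP/matrixP => i j; rewrite !mxE conj_real; congr (_%:C).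
by rewrite eq_sym mulrAC; case: eqVneq => [->|] //; rewrite !mul0r.
Qed.

(** The test vector w_i / tau_i cancels the factor tau_i tau_j of the perturbed part. The diagonal
    part, which grows as tau tends to 0, does not depend on [kappa] and later drops out. *)
Lemma quad_fun_calc_pert n (d tau : 'I_n -> R) kappa (P : {poly R}) (w : 'I_n -> R) :
    (forall i, tau i != 0) ->
  quad (fun_calc (horner P) (rank1_pert d tau kappa)) (\col_i (w i / tau i)%:C) =
  (\sum_i (w i / tau i) ^+ 2 * P.[d i]
    + kappa * \sum_i \sum_j w i * w j * pert d (fun k => tau k ^+ 2) kappa P i j)%:C.
Proof.
move=> tau0.
have PE := fun_calc_pert P _ _ (rank1_pert_hermsymmx d tau kappa).
rewrite polyseqK in PE.
rewrite (quad_real (m := fun i j => (i == j)%:R * P.[d i]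
     + kappa * tau i * tau j * pert d (fun k => tau k ^+ 2) kappa P i j)); last first.
  by move=> i j; apply: PE => k l; rewrite mxE.
congr (_%:C); rewrite mulr_sumr -big_split; apply: eq_bigr => i _ /=.
rewrite -[in RHS](sum_kronecker i (fun j => (w i / tau i) * (w j / tau j) * P.[d i])).
rewrite mulr_sumr -big_split; apply: eq_bigr => j _ /=.
by field; rewrite !tau0.
Qed.

(** Matrix convexity for diag(d) = l A + (1 - l) B, where [A] and [B] move diag(d) in opposite
    directions along tau tau^T. Here f = P on the spectrum of diag(d) and f <= P on those of [A] and
    [B], so f may be replaced by P throughout. *)
Lemma kraus_finite n a b (f : R -> R) (P : {poly R}) (al be rho : R) (d : 'I_n -> R)
    (o : 'I_n) (e : R) (w : 'I_n -> R) (s : R) (kappa := e - d o)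
    (t := fun k : 'I_n => if k == o then 1 else s : R) :
    matrix_convex n a b f -> (forall x, al <= x <= be -> in_oo a b x) ->
    (forall x, al <= x <= be -> f x <= P.[x]) ->
    (forall i, al + rho <= d i <= be - rho) -> al + rho <= e <= be - rho ->
    (forall i, f (d i) = P.[d i]) ->
    0 < s <= 1 -> n%:R * (`|kappa| * Num.sqrt s) <= rho ->
  0 <= kappa * \sum_i \sum_j w i * w j *
         (pert d t kappa P i j - pert d t (- s * kappa) P i j).
Proof.
move=> fconv ab fP dab eab fd /andP[s0 s1] s_small.
set ep := Num.sqrt s in s_small.
have ep0 : 0 < ep by rewrite sqrtr_gt0.
have ep2 : ep ^+ 2 = s by rewrite sqr_sqrtr ?ltW.
have ep1 : ep <= 1 by rewrite -(sqrtr1 R) ler_sqrt.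
have sep : s <= ep by rewrite -ep2 expr2 ler_piMr // ltW.
pose tau (k : 'I_n) : R := if k == o then 1 else ep.
have tau0 k : tau k != 0 by rewrite /tau; case: (k == o); rewrite ?oner_eq0 ?gt_eqF.
have tau_ge0 k : 0 <= tau k by rewrite /tau; case: (k == o); [exact: ler01 | exact: ltW].
have tau_le1 k : tau k <= 1 by rewrite /tau; case: (k == o).
have tE : (fun k => tau k ^+ 2) = t.
  by apply/funext => k; rewrite /tau /t; case: eqP => _; rewrite ?expr1n ?ep2.
have rho0 : 0 <= rho.
  by apply: le_trans s_small; rewrite mulr_ge0 // mulr_ge0 // ltW.
pose A := rank1_pert d tau kappa; pose B := rank1_pert d tau (- s * kappa).
have hA : A \is hermsymmx by exact: rank1_pert_hermsymmx.
have hB : B \is hermsymmx by exact: rank1_pert_hermsymmx.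
pose D := rank1_pert d tau 0.
have hD : D \is hermsymmx by exact: rank1_pert_hermsymmx.
have near_itv c x : al + rho <= c <= be - rho ->
    `|x - c| <= n%:R * (`|kappa| * ep) -> al <= x <= be.
  move=> /andP[c1 c2] /le_trans /(_ s_small); rewrite ler_norml => /andP[x1 x2].
  by apply/andP; split; lra.
(* The centres are d with d_o replaced by e: since tau_o = 1, the perturbation adds e - d_o at that
   entry and at most |kappa| ep elsewhere. *)
have eigA i : al <= eigval A i <= be.
  have [||j] := @eigval_near _ _ A
    (fun i j => (i == j)%:R * d i + kappa * tau i * tau j)
    (fun i => if i == o then e else d i) (`|kappa| * ep) i hA.
  - by move=> k l; rewrite mxE.
  - move=> k l; have [<-|kl] := eqVneq k l.
      rewrite mulr1n !mul1r -mulrA -expr2 /tau; case: eqVneq => [->|ko].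
        rewrite expr1n mulr1 /kappa (_ : d o + (e - d o) - e = 0); last by ring.
        by rewrite normr0 mulr_ge0 // ltW.
      by rewrite ep2 addrAC subrr add0r normrM ler_wpM2l // gtr0_norm.
    rewrite !mul0r add0r subr0 -mulrA normrM ler_wpM2l // ger0_norm ?mulr_ge0 //.
    have [ko|ko] := eqVneq k o.
      by rewrite /tau ko eqxx mul1r eq_sym -ko (negbTE kl).
    by rewrite {1}/tau (negbTE ko) ler_piMr ?tau_le1 // ltW.
  by case: ifP => _; apply: near_itv.
have eigB i : al <= eigval B i <= be.
  have [||j] := @eigval_near _ _ B
    (fun i j => (i == j)%:R * d i + - s * kappa * tau i * tau j) d (`|kappa| * ep) i hB.
  - by move=> k l; rewrite mxE.
  - move=> k l; rewrite addrAC subrr add0r !normrM normrN (gtr0_norm s0).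
    rewrite (ger0_norm (tau_ge0 k)) (ger0_norm (tau_ge0 l)) -!mulrA mulrCA ler_wpM2l //.
    by rewrite (le_trans _ sep) // ler_piMr ?(ltW s0) // mulr_ile1.
  exact: near_itv.
have eigD i : exists j, eigval D i = d j.
  have [||j] := @eigval_near _ _ D
    (fun i j => (i == j)%:R * d i + 0 * tau i * tau j) d 0 i hD.
  - by move=> k l; rewrite mxE.
  - by move=> k l; rewrite !mul0r addr0 subrr normr0.
  by rewrite mulr0 normr_le0 subr_eq0 => /eqP; exists j.
have sA : spectrum_in a b A by apply/spectrum_in_eigval => // i; apply: ab.
have sB : spectrum_in a b B by apply/spectrum_in_eigval => // i; apply: ab.
(* This weight makes the rank-one parts cancel: l kappa = (1 - l) s kappa. *)
pose l := s / (1 + s).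
have s1_gt0 : 0 < 1 + s by rewrite addr_gt0.
have l1E : 1 - l = (1 + s)^-1 by rewrite /l; field; rewrite gt_eqF.
have l0 : 0 < l by rewrite divr_gt0.
have l1 : 0 < 1 - l by rewrite l1E invr_gt0.
have l01 : 0 <= l <= 1 by apply/andP; split; [exact: ltW | rewrite -subr_ge0 ltW].
have ABD : l%:C *: A + (1 - l)%:C *: B = D.
  apply/matrixP => i j; rewrite !mxE -!rmorphM -rmorphD; congr (_%:C).
  by rewrite /l; field; rewrite gt_eqF.
have := fconv A B l hA hB sA sB l01; rewrite ABD.
have hY : l%:C *: fun_calc f A + (1 - l)%:C *: fun_calc f B \is hermsymmx.
  by apply: hermsymmxD; apply: hermsymmxZ; exact: fun_calc_hermsymmx.
move=> /(loewner_leE (fun_calc_hermsymmx f D) hY) /(_ (\col_i (w i / tau i)%:C)).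
rewrite [X in _ <= X]quad_lin2.
rewrite (@eq_fun_calc _ _ f (horner P) D); last first.
  by move=> i; have [j ->] := eigD i.
have quad_leP (M : 'M[C]_n) : (forall i, al <= eigval M i <= be) -> forall v,
    quad (fun_calc f M) v <= quad (fun_calc (horner P) M) v.
  by move=> eigM v; apply: quad_fun_calc_le => i; apply: fP.
have lC : 0 <= l%:C by rewrite lecR ltW.
have l1C : 0 <= (1 - l)%:C by rewrite lecR ltW.
move=> /le_trans /(_ (lerD (ler_wpM2l lC (quad_leP A eigA _)) (ler_wpM2l l1C (quad_leP B eigB _)))).
rewrite [X in X <= _](quad_fun_calc_pert _ _ _ _ tau0).
rewrite [X in _ <= _ * X + _](quad_fun_calc_pert _ _ _ _ tau0).
rewrite [X in _ <= _ + _ * X](quad_fun_calc_pert _ _ _ _ tau0).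
rewrite tE -!rmorphM -rmorphD lecR mul0r addr0.
(* The diagonal terms are the same in all three forms and cancel because the weights add up to 1. *)
move: (\sum_i (w i / tau i) ^+ 2 * P.[d i]) => Q0 ineq.
under eq_bigr do under eq_bigr do rewrite mulrBr.
under eq_bigr do rewrite sumrB.
rewrite sumrB.
move: ineq; set QA := \sum_i \sum_j w i * w j * pert d t kappa P i j.
set QB := \sum_i \sum_j w i * w j * pert d t (- s * kappa) P i j.
move=> ineq.
have : 0 <= l * (kappa * (QA - QB)).
  have : (1 - l) * s = l by rewrite l1E /l mulrC.
  move=> ls; rewrite -subr_ge0 in ineq; apply: le_trans ineq _.
  rewrite le_eqVlt; apply/orP; left; apply/eqP.
  rewrite [in LHS](_ : (1 - l) * (Q0 + - s * kappa * QB)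
    = (1 - l) * Q0 - ((1 - l) * s) * (kappa * QB)); last by ring.
  by rewrite ls; ring.
by rewrite pmulr_rge0.
Qed.

(** Let s tend to 0 from the right in [kraus_finite]. By [pert_limit] and [pert_limit0] the bracket
    tends to kappa times the second-order divided difference, so the limit is kappa^2 times the
    form. *)
Lemma kraus_psd n a b (f : R -> R) (P : {poly R}) (al be rho : R) (d : 'I_n -> R)
    (o : 'I_n) (e : R) (w : 'I_n -> R) :
    matrix_convex n a b f -> (forall x, al <= x <= be -> in_oo a b x) ->
    (forall x, al <= x <= be -> f x <= P.[x]) -> 0 < rho ->
    (forall i, al + rho <= d i <= be - rho) -> al + rho <= e <= be - rho ->
    (forall i, f (d i) = P.[d i]) -> e != d o ->
  0 <= \sum_i \sum_j w i * w j * divdiff3 P (d i) e (d j).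
Proof.
move=> fconv ab fP rho0 dab eab fd eo.
pose kappa := e - d o; have k0 : kappa != 0 by rewrite subr_eq0.
have k2 : 0 < kappa ^+ 2 by rewrite lt_neqAle eq_sym sqrf_eq0 k0 sqr_ge0.
rewrite -(pmulr_rge0 _ k2) expr2 -mulrA.
pose t (s : R) (k : 'I_n) : R := if k == o then 1 else s.
pose Phi s := kappa * \sum_i \sum_j w i * w j *
         (pert d (t s) kappa P i j - pert d (t s) (- s * kappa) P i j).
have idc : (s @[s --> (0:R)^'+] --> (0:R)) by exact: cvg_at_right_filter.
have tc k : t s k @[s --> (0:R)^'+] --> ((k == o)%:R : R).
  by rewrite /t; case: eqP => _; [exact: cvg_cst | exact: idc].
have : Phi s @[s --> (0:R)^'+] -->
    kappa * (kappa * \sum_i \sum_j w i * w j * divdiff3 P (d i) e (d j)).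
  apply: cvgM; first exact: cvg_cst.
  rewrite mulr_sumr; apply: cvg_sum_ord => i; rewrite mulr_sumr; apply: cvg_sum_ord => j.
  have -> : kappa * (w i * w j * divdiff3 P (d i) e (d j)) = w i * w j *
    (pert d (fun k => (k == o)%:R) kappa P i j - pert d (fun k => (k == o)%:R) 0 P i j).
    by rewrite /kappa pert_limit pert_limit0 polyseqK; ring.
  apply: cvgM; first exact: cvg_cst.
  apply: cvgB; apply: cvg_pert => //; first exact: cvg_cst.
  have := cvgM (cvgN idc) (cvg_cst kappa).
  by rewrite oppr0 mul0r; apply.
move=> /cvgr_to_ge; apply; near=> s.
apply: kraus_finite fconv ab fP dab eab fd _ _.
  apply/andP; split; first by near: s; exact: nbhs_right_gt.
  by apply: ltW; near: s; exact: (nbhs_right_lt ltr01).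
rewrite mulrA.
have c0 : 0 < n%:R * `|kappa| + 1 by rewrite ltr_pwDr // mulr_ge0.
apply: (@le_trans _ _ ((n%:R * `|kappa| + 1) * Num.sqrt s)).
  by rewrite ler_wpM2r ?sqrtr_ge0 // lerDl.
rewrite mulrC -ler_pdivlMr // -(ler_sqr (x := Num.sqrt s)) ?nnegrE ?sqrtr_ge0 ?divr_ge0 ?ltW //.
rewrite sqr_sqrtr; last by apply: ltW; near: s; exact: nbhs_right_gt.
by near: s; apply: nbhs_right_lt; rewrite exprn_gt0 // divr_gt0.
Unshelve. all: by end_near. Qed.

End Kraus.

(** * Scalar convexity *)

Section Convex.
Variable R : realType.
Local Notation C := R[i].

Lemma scalar_hermsymmx n (x : R) : (x%:C%:M : 'M[C]_n) \is hermsymmx.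
Proof.
apply/hermsymmxP; rewrite tr_scalar_mx map_scalar_mx.
exact: (congr1 (fun z => z%:M) (esym (conj_real x))).
Qed.

Lemma eigval_scalar n (x : R) (i : 'I_n) : eigval (x%:C%:M : 'M[C]_n) i = x.
Proof.
have hx := scalar_hermsymmx n x.
apply: (@complexI R); rewrite -(quad_eigvec i hx) /quad mul_mx_scalar -scalemxAl mxE.
by rewrite sqnormE sqnorm_eigvec mulr1.
Qed.

(** On scalar matrices the functional calculus is evaluation. Any unit vector serves as a test
    vector; an eigenvector of the zero matrix is at hand. *)
Lemma matrix_convex_scalar n a b (f : R -> R) (x y l : R) : (0 < n)%N ->
    matrix_convex n a b f -> in_oo a b x -> in_oo a b y -> 0 <= l <= 1 ->
  f (l * x + (1 - l) * y) <= l * f x + (1 - l) * f y.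
Proof.
move=> n0 fconv xab yab l01; pose o := Ordinal n0.
have herm := scalar_hermsymmx n.
have spec (z : R) : in_oo a b z -> spectrum_in a b (z%:C%:M : 'M[C]_n).
  by move=> zab; apply/spectrum_in_eigval => // i; rewrite eigval_scalar.
have := fconv _ _ _ (herm x) (herm y) (spec x xab) (spec y yab) l01.
have -> : l%:C *: x%:C%:M + (1 - l)%:C *: y%:C%:M = (l * x + (1 - l) * y)%:C%:M :> 'M[C]_n.
  by rewrite !scale_scalar_mx -raddfD /= -!rmorphM -rmorphD.
set v := eigvec (0 : 'M[C]_n) o.
have quad_sc (z : R) : quad (fun_calc f (z%:C%:M : 'M[C]_n)) v = (f z)%:C.
  rewrite quad_fun_calc; congr (_%:C); under eq_bigr do rewrite eigval_scalar.
  by rewrite -mulr_suml sum_mass sqnorm_eigvec mul1r.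
case=> _ /(_ v); rewrite -[_ 0 0]/(quad _ v) quadB subr_ge0 quad_lin2.
rewrite [X in X <= _]quad_sc [X in _ <= _ * X + _]quad_sc [X in _ <= _ + _ * X]quad_sc.
by rewrite -!rmorphM -rmorphD lecR.
Qed.

Lemma in_oo_nbhs a b (x : R) : in_oo a b x ->
  exists2 r, 0 < r & in_oo a b (x - r) /\ in_oo a b (x + r).
Proof.
move=> /andP[ax xb].
have [r1 r10 ar1] : exists2 r, 0 < r & (a < (x - r)%:E)%E.
  case: a ax => [a| |] //; last by exists 1; rewrite ?ltNyr.
  by rewrite lte_fin => ax; exists ((x - a) / 2); rewrite ?lte_fin; lra.
have [r2 r20 br2] : exists2 r, 0 < r & ((x + r)%:E < b)%E.
  case: b xb => [b| |] //; last by exists 1; rewrite ?ltry.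
  by rewrite lte_fin => xb; exists ((b - x) / 2); rewrite ?lte_fin; lra.
exists (Num.min r1 r2); first by rewrite lt_min r10.
have m1 : Num.min r1 r2 <= r1 by rewrite ge_min lexx.
have m2 : Num.min r1 r2 <= r2 by rewrite ge_min lexx orbT.
have m0 : 0 < Num.min r1 r2 by rewrite lt_min r10.
split; apply/andP; split.
- by apply: lt_le_trans ar1 _; rewrite lee_fin; lra.
- by apply: le_lt_trans _ xb; rewrite lee_fin; lra.
- by apply: lt_le_trans ax _; rewrite lee_fin; lra.
- by apply: le_lt_trans _ br2; rewrite lee_fin; lra.
Qed.

Lemma in_oo_between a b (x y z : R) : in_oo a b x -> in_oo a b y ->
  x <= z <= y -> in_oo a b z.
Proof.
move=> /andP[ax _] /andP[_ yb] /andP[xz zy]; apply/andP; split.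
  by apply: lt_le_trans ax _; rewrite lee_fin.
by apply: le_lt_trans _ yb; rewrite lee_fin.
Qed.

(** The margin [rho] leaves room inside a compact interval for perturbed eigenvalues and perturbed
    nodes. *)
Lemma in_oo_compact a b (x0 : R) (s : seq R) : in_oo a b x0 ->
    (forall x, x \in s -> in_oo a b x) ->
  exists al be rho, [/\ 0 < rho, in_oo a b al, in_oo a b be &
    forall x, x \in x0 :: s -> al + rho <= x <= be - rho].
Proof.
move=> x0ab; elim: s => [|x s IH] sab.
  have [r r0 [lr hr]] := in_oo_nbhs x0ab; exists (x0 - r), (x0 + r), r.
  by split=> // x; rewrite inE => /eqP->; apply/andP; split; lra.
have [|al [be [rho [rho0 alab beab bnd]]]] := IH.
  by move=> y ys; apply: sab; rewrite inE ys orbT.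
have [r r0 [lr hr]] := in_oo_nbhs (sab x (mem_head _ _)).
exists (Num.min al (x - r)), (Num.max be (x + r)), (Num.min rho r); split.
- by rewrite lt_min rho0.
- by case: (leP al (x - r)).
- by case: (leP be (x + r)).
have m1 : Num.min al (x - r) <= al by rewrite ge_min lexx.
have m2 : Num.min al (x - r) <= x - r by rewrite ge_min lexx orbT.
have m3 : be <= Num.max be (x + r) by rewrite le_max lexx.
have m4 : x + r <= Num.max be (x + r) by rewrite le_max lexx orbT.
have m5 : Num.min rho r <= rho by rewrite ge_min lexx.
have m6 : Num.min rho r <= r by rewrite ge_min lexx orbT.
move=> y; rewrite !inE => /or3P[y0|/eqP->|ys]; last 1 first.
- have /andP[h1 h2] : al + rho <= y <= be - rho by apply: bnd; rewrite inE ys orbT.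
  by apply/andP; split; lra.
- have /andP[h1 h2] : al + rho <= y <= be - rho by apply: bnd; rewrite inE y0.
  by apply/andP; split; lra.
- by apply/andP; split; lra.
Qed.

Variables (a b : \bar R) (f : R -> R).
Hypothesis fconv : forall x y l, in_oo a b x -> in_oo a b y -> 0 <= l <= 1 ->
  f (l * x + (1 - l) * y) <= l * f x + (1 - l) * f y.

(** Chords from [x] to x - r and x + r bound f - f(x) from above by a multiple of the distance;
    convexity across [x] gives the matching lower bound. *)
Lemma convex_continuous x : in_oo a b x -> {for x, continuous f}.
Proof.
move=> xab; have [r r0 [lr hr]] := in_oo_nbhs xab.
pose M := Num.max `|f (x - r) - f x| `|f (x + r) - f x|.
have M1 : `|f (x - r) - f x| <= M by rewrite le_max lexx.
have M2 : `|f (x + r) - f x| <= M by rewrite le_max lexx orbT.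
have M0 : 0 <= M by apply: le_trans M1.
have main (s h : R) : in_oo a b (x + s) -> in_oo a b (x - s) ->
    `|f (x + s) - f x| <= M -> `|f (x - s) - f x| <= M ->
    0 <= h <= 1 -> `|f (x + h * s) - f x| <= h * M.
  move=> ps ms pM mM /andP[h0 h1].
  have xhs : in_oo a b (x + h * s).
    have [s0|/ltW s0] := lerP 0 s.
      by apply: (in_oo_between xab ps); rewrite lerDl lerD2l mulr_ge0 // ler_piMl.
    apply: (in_oo_between ps xab); rewrite lerD2l gerDl mulr_ge0_le0 // andbT; nra.
  move: pM mM; rewrite !ler_norml => /andP[p1 p2] /andP[q1 q2]; apply/andP; split.
    (* The point x is the mean of x + h s and x - s with weights 1/(1 + h) and h/(1 + h). *)
    have := @fconv (x + h * s) (x - s) (1 + h)^-1 xhs ms.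
    have -> : (1 + h)^-1 * (x + h * s) + (1 - (1 + h)^-1) * (x - s) = x by field; lra.
    have h10 : 0 < 1 + h by lra.
    rewrite invr_ge0 invf_le1 // ltW // lerDl h0 => /(_ isT) ineq.
    have : (1 + h) * f x <= f (x + h * s) + h * f (x - s).
      apply: le_trans (ler_wpM2l (ltW h10) ineq) _; rewrite le_eqVlt; apply/orP; left.
      by apply/eqP; field; lra.
    nra.
  have := @fconv (x + s) x h ps xab.
  have -> : h * (x + s) + (1 - h) * x = x + h * s by ring.
  rewrite h0 h1 => /(_ isT); nra.
have bound y : `|y - x| <= r -> `|f y - f x| <= `|y - x| / r * M.
  move=> yr; have h01 : 0 <= `|y - x| / r <= 1.
    by rewrite divr_ge0 ?(ltW r0) //= ler_pdivrMr // mul1r.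
  have [xy|/ltW xy] := lerP x y.
    have E : `|y - x| = y - x by rewrite ger0_norm ?subr_ge0.
    have := main r _ hr lr M2 M1 h01; rewrite E divfK ?gt_eqF //.
    by have -> : x + (y - x) = y by ring.
  have E : `|y - x| = - (y - x) by rewrite ler0_norm ?subr_le0.
  have := main (- r) _ lr _ M1 _ h01; rewrite opprK => /(_ hr M2).
  rewrite mulrN divfK ?gt_eqF // E.
  have -> : x - - (y - x) = y by ring. by rewrite opprB.
have MM : 0 < M + 1 by rewrite ltr_pwDr.
apply/cvgrPdist_le => e e0; near=> y.
have yr : `|y - x| <= r by rewrite distrC; near: y; apply: cvgr_dist_le.
rewrite distrC; apply: le_trans (bound y yr) _.
have ye : `|y - x| <= e * r / (M + 1).
  rewrite distrC; near: y; apply: cvgr_dist_le; first exact: cvg_id.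
  by rewrite divr_gt0 ?mulr_gt0.
apply: (@le_trans _ _ (e * r / (M + 1) / r * M)).
  by rewrite ler_wpM2r // ler_wpM2r // invr_ge0 ltW.
have -> : e * r / (M + 1) / r * M = e * (M / (M + 1)).
  by field; rewrite !gt_eqF.
by rewrite ler_piMr ?(ltW e0) // ler_pdivrMr // mul1r lerDl.
Unshelve. all: by end_near. Qed.

(** Maximise f(y) - K (y - x)^2 over [al, be]. At a maximiser [d] a parabola touches f from above,
    and a large K keeps [d] close to [x]. *)
Lemma convex_touched_dense (al be x ep : R) :
    in_oo a b al -> in_oo a b be -> al <= x <= be -> 0 < ep ->
  exists2 d, `|d - x| < ep /\ al <= d <= be &
    exists2 p : {poly R}, p.[d] = f d & forall y, al <= y <= be -> f y <= p.[y].
Proof.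
move=> alab beab /andP[alx xbe] ep0.
have albe := le_trans alx xbe.
have cf : {within `[al, be], continuous f}.
  apply: continuous_in_subspaceT => y; rewrite inE /= in_itv /= => aly.
  exact: convex_continuous (in_oo_between alab beab aly).
have [m _ fm] := EVT_max albe cf.
(* From K (d - x)^2 <= f(d) - f(x) <= f(m) - f(x) < K ep^2 it follows that |d - x| < ep. *)
pose K := (f m - f x + 1) / ep ^+ 2.
have fxm : f x <= f m by apply: fm; rewrite in_itv /= alx.
have ep2 : 0 < ep ^+ 2 by rewrite exprn_gt0.
have K0 : 0 < K by rewrite divr_gt0 //; lra.
have cF : {within `[al, be], continuous (fun y => f y - K * (y - x) ^+ 2)}.
  apply: continuous_in_subspaceT => y; rewrite inE /= in_itv /= => aly.
  apply: cvgB; first exact: convex_continuous (in_oo_between alab beab aly).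
  apply: cvgM; first exact: cvg_cst.
  apply: (@cvg_comp _ _ _ (fun y : R => y - x) (fun z : R => z ^+ 2))
    (@exprn_continuous R 2 _).
  by apply: cvgB; [exact: cvg_id | exact: cvg_cst].
have [d] := EVT_max albe cF.
rewrite in_itv /= => ald fd.
have fdx : f x <= f d - K * (d - x) ^+ 2.
  have := fd x; rewrite in_itv /= alx xbe subrr expr0n mulr0 subr0; exact.
exists d.
  split => //; rewrite -(ltr_pXn2r (n := 2)) ?nnegrE ?normr_ge0 ?(ltW ep0) //.
  rewrite real_normK ?num_real // -(ltr_pM2l K0).
  have -> : K * ep ^+ 2 = f m - f x + 1 by rewrite /K divfK // gt_eqF.
  have := fm d; rewrite in_itv /= ald => /(_ isT); lra.
exists ((f d - K * (d - x) ^+ 2)%:P + K *: ('X - x%:P) ^+ 2) => [|y aly].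
  by rewrite !hornerE; ring.
have := fd y; rewrite in_itv /= aly => /(_ isT).
by rewrite !hornerE /=; lra.
Qed.

End Convex.

(** * Divided differences of [f q^2] *)

Section Divdiff.
Variable R : realType.

Definition divdiff (g : R -> R) m (x : 'I_m -> R) : R :=
  \sum_i g (x i) / \prod_(j | j != i) (x i - x j).

Lemma divdiff_presidue (g : R -> R) (P : {poly R}) m (x : 'I_m -> R) :
  injective x -> (forall i, g (x i) = P.[x i]) ->
  divdiff g x = presidue P (\prod_i ('X - (x i)%:P)).
Proof.
by move=> xI gP; rewrite presidue_prod_XsubC //; apply: eq_bigr => i _; rewrite gP.
Qed.

Lemma cvg_prod_cond (T : Type) (Fl : set_system T) {FF : Filter Fl} (I : Type)
    (s : seq I) (Q : pred I) (F : I -> T -> R) (l : I -> R) :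
  (forall i, F i x @[x --> Fl] --> l i) ->
  (\prod_(i <- s | Q i) F i x) @[x --> Fl] --> \prod_(i <- s | Q i) l i.
Proof.
move=> Fl_cvg; elim: s => [|i s IH].
  under eq_fun do rewrite big_nil.
  by rewrite big_nil; exact: cvg_cst.
under eq_fun do rewrite big_cons.
by rewrite big_cons; case: (Q i) => //; exact: cvgM.
Qed.

(** At distinct nodes the divided difference is continuous in the nodes. Nodes in [T] at distance
    below 1/(k + 1) are eventually distinct, and the sign passes to the limit. *)
Lemma divdiff_dense (g : R -> R) (T : R -> Prop) m (x : 'I_m -> R) :
    injective x -> (forall i, {for x i, continuous g}) ->
    (forall i (ep : R), 0 < ep -> exists2 y, `|y - x i| < ep & T y) ->
    (forall y : 'I_m -> R, injective y -> (forall i, T (y i)) -> 0 <= divdiff g y) ->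
  0 <= divdiff g x.
Proof.
move=> xI gc Tdense pos.
have approx (k : nat) (i : 'I_m) : exists y, `|y - x i| < harmonic k /\ T y.
  by have [y yx Ty] := Tdense i (harmonic k) (harmonic_gt0 k); exists y.
pose y k i := sval (cid (approx k i)).
have yP k i : `|y k i - x i| < harmonic k /\ T (y k i) := svalP (cid (approx k i)).
have yc i : (y k i) @[k --> \oo] --> x i.
  apply/cvgrPdist_lt => e e0.
  have /cvgrPdist_lt/(_ e e0) := @cvg_harmonic R.
  apply: filterS => k; rewrite sub0r normrN => kE; rewrite distrC.
  by apply: lt_trans (yP k i).1 _; apply: le_lt_trans (ler_norm _) kE.
have yx i j : (y k i - y k j) @[k --> \oo] --> x i - x j by exact: cvgB.
have yI : \forall k \near \oo, injective (y k).
  have : \forall k \near \oo, forall i j : 'I_m, i != j -> y k i - y k j != 0.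
    apply: filter_forall => i; apply: filter_forall => j.
    have [->|ij] := eqVneq i j; first by apply: nearW.
    have xij : x i - x j != 0 by rewrite subr_eq0 (inj_eq xI).
    have H := cvgr_neq0 (x i - x j) (yx i j) xij.
    by near=> k => _; near: k; exact: H.
  apply: filterS => k yk i j yij; apply/eqP; apply: contraT => /yk.
  by rewrite yij subrr eqxx.
have : divdiff g (y k) @[k --> \oo] --> divdiff g x.
  apply: cvg_sum_ord => i; apply: cvgM.
    by apply: continuous_cvg; [exact: gc | exact: yc].
  apply: cvgV; last by apply: cvg_prod_cond => j; exact: yx.
  by apply/prodf_neq0 => j ji; rewrite subr_eq0 (inj_eq xI) eq_sym.
move=> /cvgr_to_ge; apply; apply: filterS yI => k yI.
by apply: pos => // i; exact: (yP k i).2.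
Unshelve. all: by end_near. Qed.

End Divdiff.

(** * Nonnegative divided differences of f q^2 for a matrix convex f *)

Section MatrixConvexDivdiff.
Variable R : realType.

Lemma sum_widen_zero (V : nmodType) k n (F : 'I_n -> V) (G : 'I_k -> V) : (k <= n)%N ->
    (forall (i : 'I_n) (ik : (i < k)%N), F i = G (Ordinal ik)) ->
    (forall i : 'I_n, (k <= i)%N -> F i = 0) ->
  \sum_i F i = \sum_i G i.
Proof.
move=> kn FG F0; pose G' m := if insub m is Some i then G i else 0.
have -> : \sum_i G i = \sum_(i < k) G' i.
  by apply: eq_bigr => i _; rewrite /G' valK.
rewrite (big_ord_widen n G' kn) [RHS]big_mkcond /=; apply: eq_bigr => i _.
by case: ltnP => [ik|/F0 //]; rewrite (FG _ ik) /G' insubT.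
Qed.

Lemma kraus_psd_le n k a b (f : R -> R) (P : {poly R}) (al be rho : R)
    (d : 'I_k -> R) (e : R) (w : 'I_k -> R) :
    (k <= n)%N -> matrix_convex n a b f -> (forall x, al <= x <= be -> in_oo a b x) ->
    (forall x, al <= x <= be -> f x <= P.[x]) -> 0 < rho ->
    (forall i, al + rho <= d i <= be - rho) -> al + rho <= e <= be - rho ->
    (forall i, f (d i) = P.[d i]) -> (forall i, e != d i) ->
  0 <= \sum_i \sum_j w i * w j * divdiff3 P (d i) (d j) e.
Proof.
case: k d w => [|k] d w; first by rewrite big_ord0.
move=> kn fconv ab fP rho0 dab eab fd ed.
(* Padding to [n] nodes: [inord] sends an index out of range to 0, so the first node is repeated,
   with weight zero in [W]. *)
pose D (i : 'I_n) := d (inord i).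
pose W (i : 'I_n) := if (i < k.+1)%N then w (inord i) else 0.
have := @kraus_psd R n a b f P al be rho D (Ordinal (leq_trans (ltn0Sn k) kn)) e W
  fconv ab fP rho0 (fun i => dab _) eab (fun i => fd _) (ed _).
have inordE (i : 'I_n) (ik : (i < k.+1)%N) : inord i = Ordinal ik.
  by apply/val_inj; rewrite /= inordK.
rewrite (sum_widen_zero (G := fun i => \sum_j w i * w j * divdiff3 P (d i) (d j) e) kn) //.
- move=> i ik; apply: sum_widen_zero => // [j jk|j].
    by rewrite /W /D ik jk !inordE divdiff3C.
  by rewrite /W => kj; rewrite leqNgt in kj; rewrite (negbTE kj) mulr0 mul0r.
- move=> i ki; rewrite leqNgt in ki; rewrite big1 // => j _.
  by rewrite /W (negbTE ki) !mul0r.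
Qed.

(** One polynomial P touches f from above at all nodes, so f q^2 may be replaced by P q^2. Knot
    insertion reduces to double nodes, and there Kraus' inequality applies. *)
Lemma divdiff_touched n k a b (f : R -> R) (al be rho : R)
    (x : 'I_(k.*2.+1) -> R) (q : {poly R}) :
    (k <= n)%N -> matrix_convex n a b f -> (forall x, al <= x <= be -> in_oo a b x) ->
    0 < rho -> (forall i, al + rho <= x i <= be - rho) ->
    (forall i, exists2 p : {poly R}, p.[x i] = f (x i)
        & forall y, al <= y <= be -> f y <= p.[y]) ->
    injective x -> (size q <= k)%N ->
  0 <= divdiff (fun y => f y * q.[y] ^+ 2) x.
Proof.
move=> kn fconv ab rho0 xab xtouch xI sq.
pose s := [seq x i | i <- enum 'I_(k.*2.+1)].
have us : uniq s by rewrite map_inj_uniq // enum_uniq.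
have [||P Ps fP] := @touching_polynomial _ f al be s us.
- by move=> _ /mapP[i _ ->]; exact: xtouch.
- by have [p _ fp] := xtouch ord0; exists p.
rewrite (@divdiff_presidue _ _ (P * q ^+ 2)) //; last first.
  by move=> i; rewrite hornerM horner_exp Ps // map_f // mem_enum.
have -> : \prod_i ('X - (x i)%:P) = \prod_(y <- s) ('X - y%:P).
  by rewrite /s big_map big_enum.
(* The nodes that knot insertion produces are among the original ones, where P agrees with f. *)
apply: (@presidue_knots _ _ (mem s) k) => //; last by rewrite size_map size_enum_ord.
move=> D e /= /andP[eD uD] /andP[es Ds] sD.
have DP i : (i < k)%N -> nth 0 D i \in s.
  by move=> ik; apply: (allP Ds); rewrite mem_nth // sD.
have sP y : y \in s -> al + rho <= y <= be - rho by move=> /mapP[i _ ->].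
have -> : \prod_(d <- D) ('X - d%:P) ^+ 2 = (\prod_(i < k) ('X - (nth 0 D i)%:P)) ^+ 2.
  by rewrite prodrXl (big_nth 0) big_mkord sD.
apply: presidue_double_nodes => //.
  move=> i j /eqP; rewrite nth_uniq ?sD // => /eqP ij; exact: val_inj.
move=> w; apply: kraus_psd_le kn fconv ab fP rho0 _ (sP _ es) _ _ => i.
- exact/sP/DP.
- by rewrite Ps // DP.
- by apply: contraNneq eD => ->; rewrite mem_nth // sD.
Qed.

Theorem matrix_convex_divdiff n k a b (f : R -> R) (x : 'I_(k.*2.+1) -> R) (q : {poly R}) :
    (0 < n)%N -> (k <= n)%N -> matrix_convex n a b f -> (forall i, in_oo a b (x i)) ->
    injective x -> (size q <= k)%N ->
  0 <= divdiff (fun y => f y * q.[y] ^+ 2) x.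
Proof.
move=> n0 kn fconv xab xI sq.
have fc y z l := @matrix_convex_scalar R n a b f y z l n0 fconv.
have [|al [be [rho [rho0 alab beab bnd]]]] :=
    @in_oo_compact R a b (x ord0) [seq x i | i <- enum 'I_(k.*2.+1)] (xab ord0).
  by move=> _ /mapP[i _ ->].
have xbnd i : al + rho <= x i <= be - rho.
  by apply: bnd; rewrite inE map_f ?orbT // mem_enum.
(* Half of the margin is given up here so that nodes can be moved to touched points; the other half
   is passed on to [divdiff_touched]. *)
pose T y := al + rho / 2 <= y <= be - rho / 2 /\ exists2 p : {poly R}, p.[y] = f y
        & forall z, al <= z <= be -> f z <= p.[z].
apply: (@divdiff_dense _ _ T) => // [i|i ep ep0|y yI yT].
- apply: cvgM; first exact: (convex_continuous fc).
  apply: (@cvg_comp _ _ _ (horner q) (fun z : R => z ^+ 2)) (@exprn_continuous R 2 _).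
  exact: continuous_horner.
- have /andP[x1 x2] := xbnd i.
  have r0 : 0 < Num.min ep (rho / 2) by rewrite lt_min ep0; lra.
  have [|d [dx _] dp] := convex_touched_dense fc alab beab _ r0 (x := x i).
    by apply/andP; split; lra.
  move: dx; rewrite lt_min => /andP[dx]; rewrite ltr_norml => /andP[d1 d2].
  by exists d => //; split=> //; apply/andP; split; lra.
- apply: (@divdiff_touched n k a b f al be (rho / 2)) => //.
  + by move=> z; exact: in_oo_between.
  + by lra.
  + by move=> i; have [] := yT i.
  + by move=> i; have [] := yT i.
Qed.

End MatrixConvexDivdiff.

(** * The divided difference of [f] as a function *)

Section Derivable.
Variable R : realType.
Variables (a b : \bar R) (f : R -> R) (t : R).
Hypothesis tab : in_oo a b t.
Hypothesis fconv : forall x y l, in_oo a b x -> in_oo a b y -> 0 <= l <= 1 ->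
  f (l * x + (1 - l) * y) <= l * f x + (1 - l) * f y.
(** The fourth central difference, which is 24 h^4 times the divided difference of [f] at t - 2h, t
    - h, t, t + h, t + 2h. *)
Hypothesis f4 : forall h, 0 < h -> in_oo a b (t - 2 * h) -> in_oo a b (t + 2 * h) ->
  0 <= f (t - 2 * h) - 4 * f (t - h) + 6 * f t - 4 * f (t + h) + f (t + 2 * h).

Let slope k := (f (t + k) - f t) / k.

Lemma convex_chord u v w : in_oo a b u -> in_oo a b w -> u < v < w ->
  (w - u) * f v <= (w - v) * f u + (v - u) * f w.
Proof.
move=> uab wab /andP[uv vw]; have uw : 0 < w - u by lra.
have := @fconv u w ((w - v) / (w - u)) uab wab.
have -> : (w - v) / (w - u) * u + (1 - (w - v) / (w - u)) * w = v.
  by field; rewrite gt_eqF.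
rewrite divr_ge0 ?ler_pdivrMr //; try lra.
have -> : w - v <= 1 * (w - u) by lra.
move=> /(_ isT) /(ler_wpM2l (ltW uw)) /le_trans; apply.
by rewrite le_eqVlt; apply/orP; left; apply/eqP; field; rewrite gt_eqF.
Qed.

Lemma slope_mono k k' : in_oo a b (t + k) -> in_oo a b (t + k') ->
  k != 0 -> k' != 0 -> k < k' -> slope k <= slope k'.
Proof.
move=> kab k'ab k0 k'0 kk'; rewrite -subr_ge0 /slope.
have -> : (f (t + k') - f t) / k' - (f (t + k) - f t) / k =
  (k * (f (t + k') - f t) - k' * (f (t + k) - f t)) / (k * k').
  by field; rewrite k0 k'0.
(* In each order of the points t, t + k, t + k' the chord inequality is applied at the middle
   one. *)
have [kpos|kneg|kz] := ltgtP k 0; last by rewrite kz eqxx in k0.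
  have [k'neg|k'pos|kz] := ltgtP k' 0; last by rewrite kz eqxx in k'0.
    have := convex_chord kab tab (v := t + k').
    have -> : t + k < t + k' < t by apply/andP; split; lra.
    move=> /(_ isT) H; apply: divr_ge0; first by nra.
    by rewrite mulr_le0 // ltW.
  have := convex_chord kab k'ab (v := t).
  have -> : t + k < t < t + k' by apply/andP; split; lra.
  move=> /(_ isT) H; rewrite -mulrNN -invrN; apply: divr_ge0; first by nra.
  by rewrite oppr_ge0 mulr_le0_ge0 // ltW.
have := convex_chord tab k'ab (v := t + k).
have -> : t < t + k < t + k' by apply/andP; split; lra.
move=> /(_ isT) H; apply: divr_ge0; first by nra.
by rewrite mulr_ge0 // ltW // (lt_trans kneg).
Qed.

(** The gap between right and left slopes at distance h is the second difference over h. By [f4] it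
    at least halves when h does, so the one-sided derivatives coincide. *)
Lemma convex_slope_cvg : exists L, forall ep, 0 < ep ->
  exists2 delta, 0 < delta & forall h, h != 0 -> `|h| <= delta -> `|slope h - L| <= ep.
Proof.
have [r r0 [lr hr]] := in_oo_nbhs tab.
have rab h : `|h| <= r -> in_oo a b (t + h).
  rewrite ler_norml => /andP[h1 h2]; apply: (in_oo_between lr hr).
  by apply/andP; split; lra.
pose gap h := slope h - slope (- h).
have gap_half h : 0 < h -> 2 * h <= r -> gap h <= gap (2 * h) / 2.
  move=> h0 hr2; have h20 : 0 < 2 * h by rewrite mulr_gt0.
  have H : 0 <= f (t - 2 * h) - 4 * f (t - h) + 6 * f t - 4 * f (t + h) + f (t + 2 * h).
    by apply: f4 => //; apply: rab; rewrite ?normrN gtr0_norm.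
  rewrite /gap /slope -subr_ge0.
  have -> : ((f (t + 2 * h) - f t) / (2 * h) - (f (t + - (2 * h)) - f t) / - (2 * h)) / 2 -
    ((f (t + h) - f t) / h - (f (t + - h) - f t) / - h) =
    (f (t - 2 * h) - 4 * f (t - h) + 6 * f t - 4 * f (t + h) + f (t + 2 * h)) / (4 * h).
    by field; rewrite gt_eqF.
  by rewrite divr_ge0 // mulr_ge0 // ltW.
have gap_pow k : gap (r / 2 ^+ k) <= gap r / 2 ^+ k.
  elim: k => [|k IH]; first by rewrite !expr0 !divr1.
  have p0 : 0 < (2 : R) ^+ k by rewrite exprn_gt0.
  have p1 : 1 <= (2 : R) ^+ k by rewrite exprn_ege1 // ler1n.
  have E : 2 * (r / 2 ^+ k.+1) = r / 2 ^+ k.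
    by rewrite exprS; field; rewrite gt_eqF.
  apply: le_trans (gap_half _ _ _) _.
  - by rewrite divr_gt0 // exprn_gt0.
  - by rewrite E ler_pdivrMr // ler_peMr // ltW.
  have -> : gap r / 2 ^+ k.+1 = gap r / 2 ^+ k / 2.
    by rewrite exprS; field; rewrite gt_eqF.
  by rewrite E ler_pM2r // invr_gt0.
(* By monotonicity every right slope bounds every left slope, so the supremum of the left slopes
   separates the two families. *)
pose E := [set slope (- h) | h in [set h | 0 < h <= r]].
have Eub h : 0 < h <= r -> ubound E (slope h).
  move=> /andP[h0 hr'] _ [k /= /andP[k0 kr] <-]; apply: slope_mono.
  - by apply: rab; rewrite normrN gtr0_norm.
  - by apply: rab; rewrite gtr0_norm.
  - by rewrite oppr_eq0 gt_eqF.
  - by rewrite gt_eqF.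
  - by apply: lt_trans h0; rewrite oppr_lt0.
have rr : 0 < r <= r by rewrite r0 lexx.
have E0 : has_sup E by split; [exists (slope (- r)), r | exists (slope r); exact: Eub].
pose L := sup E.
have L1 h : 0 < h <= r -> slope (- h) <= L.
  by move=> hr'; apply: (ub_le_sup E0.2); exists h.
have L2 h : 0 < h <= r -> L <= slope h.
  by move=> hr'; apply: ge_sup (Eub _ hr'); exact: E0.1.
exists L => ep ep0.
have [k kP] : exists k, gap r / 2 ^+ k <= ep.
  have [k kP] : exists k : nat, `|gap r| / ep < k%:R.
    by exists (Num.trunc (`|gap r| / ep)).+1; rewrite truncnS_gt.
  exists k; rewrite ler_pdivrMr ?exprn_gt0 //.
  apply: le_trans (ler_norm _) _; rewrite -ler_pdivrMl // mulrC; apply: (le_trans (ltW kP)).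
  by rewrite -natrX ler_nat ltnW // ltn_expl.
pose d := r / 2 ^+ k.
have d0 : 0 < d by rewrite divr_gt0 ?exprn_gt0.
have dr : d <= r by rewrite ler_pdivrMr ?exprn_gt0 // ler_peMr ?(ltW r0) // exprn_ege1 // ler1n.
exists d => // h h0 hd.
have gapd : slope d - slope (- d) <= ep by exact: le_trans (gap_pow k) kP.
have [hd1 hd2] : - d <= h /\ h <= d by move: hd; rewrite ler_norml => /andP[].
have dab : in_oo a b (t + d) by apply: rab; rewrite gtr0_norm.
have dab' : in_oo a b (t + - d) by apply: rab; rewrite normrN gtr0_norm.
have hab : in_oo a b (t + h) by apply: rab; apply: le_trans hd dr.
have s1 : slope (- d) <= slope h.
  move: hd1; rewrite le_eqVlt => /predU1P[->//|hd1].
  by apply: slope_mono => //; rewrite oppr_eq0 gt_eqF.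
have s2 : slope h <= slope d.
  move: hd2; rewrite le_eqVlt => /predU1P[->//|hd2].
  by apply: slope_mono => //; rewrite gt_eqF.
have d0r : 0 < d <= r by rewrite d0.
have := L1 d d0r; have := L2 d d0r; rewrite ler_norml => l1 l2.
by apply/andP; split; lra.
Qed.

Lemma divided_difference_continuous_at : {for t, continuous (divided_difference f ^~ t)}.
Proof.
have [L LP] := convex_slope_cvg.
have dL : derive1 f t = L.
  rewrite /derive1; apply/cvg_lim => //; apply/cvgrPdist_le => ep ep0.
  have [d d0 dP] := LP ep ep0.
  near=> h; rewrite distrC /=.
  have -> : h^-1 *: (f (h + t) - f t) = slope h by rewrite /slope [t + h]addrC mulrC.
  apply: dP.
    by near: h; exact: nbhs_dnbhs_neq.
  by near: h; exact: dnbhs0_le.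
apply/cvgrPdist_le => ep ep0; have [d d0 dP] := LP ep ep0.
near=> y; rewrite /divided_difference eqxx dL distrC.
case: eqVneq => [_|yt]; first by rewrite subrr normr0 ltW.
have := dP (y - t); rewrite subr_eq0 yt => /(_ isT).
rewrite /slope [t + _]addrC subrK; apply.
by rewrite distrC; near: y; apply: cvgr_dist_le.
Unshelve. all: by end_near. Qed.

End Derivable.

(** * Transfer from f to its divided difference with one node fixed *)

Section DividedDifference.
Variable R : realType.

Lemma divided_difference_continuous a b (f : R -> R) (t : R) (n : nat) x :
    (2 <= n)%N -> matrix_convex n a b f -> in_oo a b t -> in_oo a b x ->
  {for x, continuous (divided_difference f ^~ t)}.
Proof.
move=> n2 fconv tab xab; have n0 : (0 < n)%N := ltnW n2.
have fc y z l := @matrix_convex_scalar R n a b f y z l n0 fconv.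
have [->|xt] := eqVneq x t.
  apply: (divided_difference_continuous_at tab fc) => h h0 lo hi.
  (* Five equidistant nodes centred at t, with q = 1; this is the case k = 2, allowed since n >=
     2. *)
  pose X (i : 'I_(2.*2.+1)) := t + (i%:R - 2) * h.
  have XI : injective X.
    move=> i j /addrI /(mulIf (lt0r_neq0 h0)) /addIr /eqP.
    by rewrite eqr_nat => /eqP; exact: val_inj.
  have Xab i : in_oo a b (X i).
    apply: (in_oo_between lo hi).
    have i4 : (i%:R : R) <= 4 by rewrite ler_nat -ltnS.
    have i0 : 0 <= (i%:R : R) by [].
    by rewrite /X; apply/andP; split; nra.
  have := @matrix_convex_divdiff R n 2 a b f X 1 n0 n2 fconv Xab XI.
  rewrite size_poly1 => /(_ isT).
  rewrite /divdiff !big_ord_recl big_ord0 /=.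
  do 5 (rewrite big_mkcond !big_ord_recl big_ord0 /=).
  rewrite /X /= !hornerC !expr1n !mulr1.
  have b1 : (bump 0 0)%:R = 1 :> R by [].
  have b2 : (bump 0 (bump 0 0))%:R = 2 :> R by [].
  have b3 : (bump 0 (bump 0 (bump 0 0)))%:R = 3 :> R by [].
  have b4 : (bump 0 (bump 0 (bump 0 (bump 0 0))))%:R = 4 :> R by [].
  rewrite b4 b3 b2 b1.
  have -> : t + (0 - 2) * h = t - 2 * h by ring.
  have -> : t + (1 - 2) * h = t - h by ring.
  have -> : t + (2 - 2) * h = t by ring.
  have -> : t + (3 - 2) * h = t + h by ring.
  have -> : t + (4 - 2) * h = t + 2 * h by ring.
  set S := (X in 0 <= X -> _) => S0.
  (* The products of node differences are 24, -6, 4, -6, 24 times h^4, whence the weights 1, -4, 6,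
     -4, 1. *)
  have -> : f (t - 2 * h) - 4 * f (t - h) + 6 * f t - 4 * f (t + h) + f (t + 2 * h)
      = 24 * h ^+ 4 * S.
    rewrite /S; field. by do ![apply/andP; split]; apply/eqP => E; lra.
  by rewrite mulr_ge0 // mulr_ge0 // exprn_ge0 // ltW.
have xt0 : x - t != 0 by rewrite subr_eq0.
have cq : (fun y => (f y - f t) / (y - t)) @ x --> (f x - f t) / (x - t).
  apply: cvgM.
    by apply: cvgB; [exact: (convex_continuous fc) | exact: cvg_cst].
  by apply: cvgV => //; apply: cvgB; [exact: cvg_id | exact: cvg_cst].
rewrite /prop_for /continuous_at {2}/divided_difference (negbTE xt).
apply: cvg_trans cq; apply: near_eq_cvg.
have xtn : \forall y \near x, y - t != 0.
  have H : (fun y => y - t) @ x --> x - t by apply: cvgB; [exact: cvg_id | exact: cvg_cst].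
  exact: (cvgr_neq0 _ H xt0).
near=> y; rewrite /divided_difference ifN //.
by rewrite -subr_eq0; near: y.
Unshelve. all: by end_near. Qed.

(** Add [t] as a node and consider (f - f(t)) q^2. Its term at [t] vanishes, and elsewhere the
    factor y_i - t in the denominator turns f - f(t) into the divided difference. Nodes equal to [t]
    are reached by density. *)
Lemma divided_difference_divdiff n k a b (f : R -> R) (t : R)
    (x : 'I_(k.*2) -> R) (q : {poly R}) :
    (2 <= n)%N -> (k <= n)%N -> matrix_convex n a b f -> in_oo a b t ->
    (forall i, in_oo a b (x i)) -> injective x -> (size q <= k)%N ->
  0 <= divdiff (fun y => divided_difference f y t * q.[y] ^+ 2) x.
Proof.
move=> n2 kn fconv tab xab xI sq; have n0 : (0 < n)%N := ltnW n2.
apply: (@divdiff_dense _ _ (fun y => in_oo a b y /\ y != t)) => // [i|i ep ep0|y yI yT].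
- apply: cvgM; first exact: (divided_difference_continuous n2 fconv).
  apply: (@cvg_comp _ _ _ (horner q) (fun z : R => z ^+ 2)) (@exprn_continuous R 2 _).
  exact: continuous_horner.
- have [xt|xt] := eqVneq (x i) t; last by exists (x i); rewrite ?subrr ?normr0.
  have [r r0 [lr hr]] := in_oo_nbhs (xab i).
  pose d := Num.min ep r / 2.
  have m1 : Num.min ep r <= ep by rewrite ge_min lexx.
  have m2 : Num.min ep r <= r by rewrite ge_min lexx orbT.
  have m0 : 0 < Num.min ep r by rewrite lt_min ep0.
  exists (x i + d); first by rewrite addrAC subrr add0r gtr0_norm /d; lra.
  split; last by rewrite -xt -subr_eq0 addrAC subrr add0r /d; lra.
  by apply: (in_oo_between lr hr); rewrite /d; apply/andP; split; lra.
pose X (i : 'I_(k.*2.+1)) := if unlift ord0 i is Some j then y j else t.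
have X0 : X ord0 = t by rewrite /X unlift_none.
have XS i : X (lift ord0 i) = y i by rewrite /X liftK.
have XI : injective X.
  move=> i j; case: (unliftP ord0 i) => [i'|] ->; case: (unliftP ord0 j) => [j'|] ->;
    rewrite ?X0 ?XS // => E.
  - by rewrite (yI _ _ E).
  - by have [_] := yT i'; rewrite E eqxx.
  - by have [_] := yT j'; rewrite -E eqxx.
have Xab i : in_oo a b (X i).
  by case: (unliftP ord0 i) => [i'|] ->; rewrite ?X0 ?XS //; have [] := yT i'.
have XE (g : R -> R) : divdiff g X = g t / \prod_j (t - y j)
    + \sum_i g (y i) / ((y i - t) * \prod_(j | j != i) (y i - y j)).
  rewrite /divdiff big_ord_recl X0; congr (_ / _ + _).
    rewrite big_mkcond big_ord_recl /= mul1r; apply: eq_bigr => j _.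
    by rewrite XS.
  apply: eq_bigr => i _; rewrite XS; congr (_ / _).
  rewrite big_mkcond big_ord_recl /= X0; congr (_ * _).
  rewrite [RHS]big_mkcond; apply: eq_bigr => j _.
  by rewrite (inj_eq lift_inj) XS.
have := matrix_convex_divdiff n0 kn fconv Xab XI sq.
(* The degree of q^2 is at most 2k - 2, below the order 2k, so subtracting f(t) q^2 changes
   nothing. *)
have q0 : divdiff (fun y => q.[y] ^+ 2) X = 0.
  rewrite (@divdiff_presidue _ _ (q ^+ 2)) //; last by move=> i; rewrite horner_exp.
  apply: presidue_small; rewrite size_prod_XsubC /index_enum -enumT size_enum_ord.
  rewrite ltnS expr2; apply: leq_ltn_trans (size_polyMleq _ _) _.
  by move: sq; clear; case: (size q) => [|s]; lia.
have -> : divdiff (fun y => f y * q.[y] ^+ 2) X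
    = divdiff (fun y => f y * q.[y] ^+ 2) X - f t * divdiff (fun y => q.[y] ^+ 2) X.
  by rewrite q0 mulr0 subr0.
rewrite !XE mulrDr mulr_sumr opprD addrACA mulrA subrr add0r -sumrB.
rewrite [X in 0 <= X -> _](_ : _ = divdiff (fun y => divided_difference f y t * q.[y] ^+ 2) y) //.
apply: eq_bigr => i _; have [_ yt] := yT i.
rewrite /divided_difference (negbTE yt) invfM.
by move: (y i - t)^-1 (\prod_(j | j != i) _)^-1 => u v; ring.
Qed.

End DividedDifference.

(** * Cancellation of multiple nodes *)

Section Interlacing.
Variable R : realType.
Implicit Types (G N P q : {poly R}) (s th : seq R).

Lemma poly_interp (g : R -> R) s : exists G, forall x, x \in s -> G.[x] = g x.
Proof.
elim: s => [|z s [G GP]]; first by exists 0.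
have [zs|zs] := boolP (z \in s).
  by exists G => x; rewrite inE => /predU1P[->|]; exact: GP.
pose w := \prod_(y <- s) ('X - y%:P).
have wz : w.[z] != 0.
  rewrite horner_prod_XsubC prodf_seq_neq0; apply/allP => y ys /=.
  by rewrite subr_eq0; apply: contraNneq zs => ->.
exists (G + ((g z - G.[z]) / w.[z]) *: w) => x; rewrite inE hornerD hornerZ => /predU1P[->|xs].
  by rewrite divfK // addrC subrK.
have -> : w.[x] = 0 by rewrite horner_prod_XsubC (big_rem x) //= subrr mul0r.
by rewrite mulr0 addr0 GP.
Qed.

Lemma poly_eq0_horner P : (forall t, P.[t] = 0) -> P = 0.
Proof.
move=> P0; apply: (@roots_geq_poly_eq0 _ P [seq i%:R | i <- iota 0 (size P)]).
- by apply/allP => _ /mapP[i _ ->]; rewrite /root P0.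
- by rewrite map_inj_uniq ?iota_uniq // => i j /eqP; rewrite eqr_nat => /eqP.
- by rewrite size_map size_iota.
Qed.

(* [(N1^2 + N2^2) / prod_s] has only simple poles, since it equals [P / prod_th] with [th]
   duplicate-free; hence repeated nodes of [s] cancel against common roots of [N1] and
   [N2], until the nodes are distinct. *)
Lemma presidue_sumsqr_ge0 n (g : R -> R) (I : R -> Prop) :
    (forall k (x : 'I_(k.*2) -> R) q, (k <= n)%N -> (forall i, I (x i)) -> injective x ->
       (size q <= k)%N -> 0 <= divdiff (fun y => g y * q.[y] ^+ 2) x) ->
  forall k s th G N1 N2 P, (k <= n)%N -> size s = k.*2 -> (forall x, x \in s -> I x) ->
    uniq th -> (size N1 <= k)%N -> (size N2 <= k)%N ->
    (forall x, x \in s -> G.[x] = g x) ->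
    (N1 ^+ 2 + N2 ^+ 2) * \prod_(y <- th) ('X - y%:P) = \prod_(y <- s) ('X - y%:P) * P ->
  0 <= presidue (G * (N1 ^+ 2 + N2 ^+ 2)) (\prod_(y <- s) ('X - y%:P)).
Proof.
move=> gpos; elim=> [|k IH] s th G N1 N2 P kn ss sI uth sN1 sN2 Gg E.
  move: sN1 sN2; rewrite !leqn0 !size_poly_eq0 => /eqP-> /eqP->.
  by rewrite expr0n addr0 mulr0 presidue0.
(* Distinct nodes: the hypothesis on divided differences applies to N1 and to N2 separately. *)
have [us|] := boolP (uniq s).
  pose x (i : 'I_(k.+1.*2)) := nth 0 s i.
  have xs i : x i \in s by rewrite mem_nth // ss.
  have xI : injective x.
    by move=> i j /eqP; rewrite nth_uniq ?ss // => /eqP /val_inj.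
  have -> : \prod_(y <- s) ('X - y%:P) = \prod_i ('X - (x i)%:P).
    by rewrite (big_nth 0) big_mkord ss.
  rewrite mulrDr presidueD; apply: addr_ge0.
    rewrite -(@divdiff_presidue _ (fun y => g y * N1.[y] ^+ 2)) //.
      by apply: gpos => // i; exact: sI.
    by move=> i; rewrite hornerM horner_exp Gg.
  rewrite -(@divdiff_presidue _ (fun y => g y * N2.[y] ^+ 2)) //.
    by apply: gpos => // i; exact: sI.
  by move=> i; rewrite hornerM horner_exp Gg.
move=> nus.
have [z [s' ps]] : exists z s', perm_eq s (z :: z :: s').
  elim: s nus {ss sI Gg E} => //= y s IHs; rewrite negb_and negbK => /orP[ys|/IHs[z [s' ps]]].
    exists y, (rem y s); rewrite perm_cons; exact: perm_to_rem.
  exists z, (y :: s'); apply: perm_trans (_ : perm_eq (y :: z :: z :: s') _).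
    by rewrite perm_cons.
  exact: permEl (perm_catCA [:: y] [:: z; z] s').
have s's x : x \in s' -> x \in s by move=> xs'; rewrite (perm_mem ps) !inE xs' !orbT.
have prodE : \prod_(y <- s) ('X - y%:P) =
    \prod_(y <- s') ('X - y%:P) * ('X - z%:P) ^+ 2.
  by rewrite (perm_big _ ps) /= !big_cons; ring.
have prod_neq0 t : z \notin t -> (\prod_(y <- t) ('X - y%:P)).[z] != 0.
  move=> zt; rewrite horner_prod_XsubC prodf_seq_neq0; apply/allP => y yt /=.
  by rewrite subr_eq0; apply: contraNneq zt => ->.
have Xz0 : 'X - z%:P != 0 by rewrite polyXsubC_eq0.
(* On the right of [E] the root [z] is at least double, while [th] accounts for it at most once, so
   it is a root of N1^2 + N2^2. Over the reals both N1 and N2 then vanish there, and (X - z)^2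
   cancels. *)
have Nz : N1.[z] ^+ 2 + N2.[z] ^+ 2 = 0.
  rewrite -!horner_exp -hornerD.
  move: E; rewrite prodE; set S := N1 ^+ 2 + N2 ^+ 2; set U := \prod_(y <- s') _ => E.
  have [zth|zth] := boolP (z \in th); last first.
    have RHS0 : (U * ('X - z%:P) ^+ 2 * P).[z] = 0.
      by rewrite 2!hornerM horner_exp hornerXsubC subrr expr0n mulr0 mul0r.
    move/eqP: RHS0; rewrite -E hornerM.
    by rewrite mulf_eq0 (negbTE (prod_neq0 _ zth)) orbF => /eqP.
  have zrem : z \notin rem z th by rewrite mem_rem_uniq // !inE eqxx.
  move: E; rewrite (big_rem z) //= => E.
  have E1 : S * \prod_(y <- rem z th) ('X - y%:P) = U * ('X - z%:P) * P.
    apply: (mulfI Xz0); transitivity (S * (('X - z%:P) * \prod_(y <- rem z th) ('X - y%:P))).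
      by ring.
    by rewrite E; ring.
  have RHS0 : (U * ('X - z%:P) * P).[z] = 0.
    by rewrite 2!hornerM hornerXsubC subrr mulr0 mul0r.
  move/eqP: RHS0; rewrite -E1 hornerM.
  by rewrite mulf_eq0 (negbTE (prod_neq0 _ zrem)) orbF => /eqP.
move/eqP: Nz; rewrite paddr_eq0 ?sqr_ge0 // !sqrf_eq0 => /andP[r1 r2].
have /factor_theorem[Q1 Q1E] : root N1 z by [].
have /factor_theorem[Q2 Q2E] : root N2 z by [].
have szQ (Q : {poly R}) : (size (Q * ('X - z%:P))%R <= k.+1)%N -> (size Q <= k)%N.
  have [->|Q0] := eqVneq Q 0; first by rewrite size_poly0.
  by rewrite size_Mmonic ?monicXsubC // size_XsubC addn2.
have NE : N1 ^+ 2 + N2 ^+ 2 = (Q1 ^+ 2 + Q2 ^+ 2) * ('X - z%:P) ^+ 2.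
  by rewrite Q1E Q2E; ring.
rewrite prodE NE mulrA presidue_mul2r ?rpredX ?monicXsubC ?monic_prod_XsubC //.
apply: (IH _ th _ _ _ P).
- exact: ltnW.
- by have := perm_size ps; rewrite ss doubleS /= => -[].
- by move=> x /s's; exact: sI.
- by [].
- by apply: szQ; rewrite -Q1E.
- by apply: szQ; rewrite -Q2E.
- by move=> x /s's; exact: Gg.
apply: (mulIf (expf_neq0 2 Xz0)); move: E; rewrite prodE NE => E.
transitivity ((Q1 ^+ 2 + Q2 ^+ 2) * ('X - z%:P) ^+ 2 * \prod_(y <- th) ('X - y%:P)); first by ring.
by rewrite E; ring.
Qed.

(** The matrix determinant lemma, by comparing determinants in the identity L U = V L of block
    triangular matrices. *)
Lemma det_sub_rank1 (F : fieldType) n (u : 'cV[F]_n) (v : 'rV[F]_n) :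
  \det (1%:M - u *m v) = 1 - (v *m u) 0 0.
Proof.
pose L : 'M[F]_(1 + n) := block_mx 1%:M 0 u 1%:M.
pose U : 'M[F]_(1 + n) := block_mx 1%:M v 0 (1%:M - u *m v).
pose V : 'M[F]_(1 + n) := block_mx (1%:M - v *m u) v 0 1%:M.
have : L *m U = V *m L.
  rewrite /L /U /V !mulmx_block !mul1mx !mulmx1 !mul0mx !mulmx0.
  by rewrite !addr0 !add0r subrK addrC subrK.
move=> /(congr1 determinant); rewrite !det_mulmx /L /U /V det_lblock !det_ublock.
by rewrite !det1 !mul1r !mulr1 => ->; rewrite det_mx11 !mxE eqxx.
Qed.

End Interlacing.

(** * Rank-one increments *)

Section Numerator.
Variables (R : realType) (n : nat).
Implicit Types (a c : 'I_n -> R) (G : {poly R}).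

Definition nodal a : {poly R} := \prod_i ('X - (a i)%:P).
(** The numerator of the sum of c_i / (t - a_i) over the common denominator [nodal a]. *)
Definition numer a c : {poly R} := \sum_i c i *: \prod_(j | j != i) ('X - (a j)%:P).

Lemma nodal_monic a : nodal a \is monic.
Proof. exact: monic_prod_XsubC. Qed.

Lemma nodalE a i : nodal a = \prod_(j | j != i) ('X - (a j)%:P) * ('X - (a i)%:P).
Proof. by rewrite /nodal (bigD1 i) //= mulrC. Qed.

Lemma size_numer a c : (size (numer a c) <= n)%N.
Proof.
apply: leq_trans (size_sum _ _ _) _; apply/bigmax_leqP => i _.
by apply: leq_trans (size_scale_leq _ _) _; rewrite size_prod_XsubC_neq.
Qed.

Lemma nodal_neq0 a t i : (nodal a).[t] != 0 -> t - a i != 0.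
Proof.
by rewrite (nodalE a i) hornerM hornerXsubC mulf_eq0 negb_or => /andP[].
Qed.

Lemma horner_numer a c t : (nodal a).[t] != 0 ->
  \sum_i c i / (t - a i) = (numer a c).[t] / (nodal a).[t].
Proof.
move=> ta; rewrite horner_sum mulr_suml; apply: eq_bigr => i _.
have ti := nodal_neq0 i ta.
move: ta; rewrite hornerZ (nodalE a i) hornerM hornerXsubC mulf_eq0 negb_or => /andP[p0 _].
by field; rewrite ti p0.
Qed.

Lemma presidue_numer G a c : presidue (G * numer a c) (nodal a) = \sum_i c i * G.[a i].
Proof.
rewrite mulr_sumr presidue_sum; apply: eq_bigr => i _.
rewrite -scalerAr presidueZ (nodalE a i) [X in presidue _ X]mulrC.
by rewrite presidue_mul2r ?monicXsubC ?monic_prod_XsubC // presidue_XsubC.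
Qed.

(** Even with repeated a_i, a sum of c_i / (t - a_i) has only simple poles, so a denominator listing
    each pole once suffices. *)
Lemma numer_simple_poles a c (th : seq R) : (forall i, a i \in th) ->
  exists P, numer a c * \prod_(y <- th) ('X - y%:P) = nodal a * P.
Proof.
move=> ath; exists (\sum_i c i *: \prod_(y <- rem (a i) th) ('X - y%:P)).
rewrite mulr_suml mulr_sumr; apply: eq_bigr => i _.
by rewrite (nodalE a i) (big_rem _ (ath i)) /= -scalerAl -scalerAr; congr (_ *: _); ring.
Qed.

End Numerator.

(** * Resolvents under a rank-one increment *)

Section RankOne.
Variable R : realType.
Local Notation C := R[i].

Lemma bilin_fun_calc n (f : R -> R) (A : 'M[C]_n) (v w : 'cV[C]_n) :
  (v^t* *m fun_calc f A *m w) 0 0 =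
  \sum_i Num.conj ((spectralmx A *m v) i 0) * (spectralmx A *m w) i 0 * (f (eigval A i))%:C.
Proof.
rewrite fun_calcE /specmx !mulmxA -mulmxA -map_mxM -trmx_mul.
rewrite mxE; apply: eq_bigr => i _.
by rewrite mul_mx_diag !mxE mulrAC.
Qed.

Lemma det_fun_calc n (f : R -> R) (A : 'M[C]_n) :
  \det (fun_calc f A) = (\prod_i f (eigval A i))%:C.
Proof.
rewrite fun_calcE /specmx !det_mulmx mulrAC -det_mulmx spectralmxKr det1 mul1r det_diag.
by rewrite rmorph_prod; apply: eq_bigr => i _; rewrite mxE.
Qed.

Lemma resolventE n (A : 'M[C]_n) (t : R) : A \is hermsymmx ->
  fun_calc (fun x => t - x) A = t%:C%:M - A.
Proof.
move=> hA; rewrite (@eq_fun_calc _ _ _ (fun x => t + -1 * x)); last by move=> i; ring.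
rewrite fun_calcD fun_calcM fun_calc_id // !fun_calc_cst.
by rewrite mul_scalar_mx rmorphN1 scaleN1r.
Qed.

Lemma conj_mul_real (z1 z2 : C) (r : R) :
  Num.conj (Num.conj z1 * z2 * r%:C) = Num.conj z2 * z1 * r%:C.
Proof.
case: z1 z2 => [x1 y1] [x2 y2]; rewrite !conjCc; apply/eqP; rewrite eq_complex /=.
by apply/andP; split; apply/eqP; ring.
Qed.

Definition is_resolvent n (A RA : 'M[C]_n) (t : R) :=
  [/\ (t%:C%:M - A) *m RA = 1%:M, RA *m (t%:C%:M - A) = 1%:M &
   forall v w : 'cV[C]_n, (v^t* *m RA *m w) 0 0 =
     \sum_i Num.conj ((spectralmx A *m v) i 0) * (spectralmx A *m w) i 0
        * ((t - eigval A i)^-1)%:C].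

Lemma resolvent_exists n (A : 'M[C]_n) (t : R) : A \is hermsymmx ->
  (forall i, t - eigval A i != 0) -> exists RA, is_resolvent A RA t.
Proof.
move=> hA t0; exists (fun_calc (fun x => (t - x)^-1) A).
have E : (t%:C%:M - A) *m fun_calc (fun x => (t - x)^-1) A = 1%:M.
  rewrite -resolventE // -fun_calcM (@eq_fun_calc _ _ _ (fun=> 1)) ?fun_calc_cst //.
  by move=> i; rewrite divff.
by split; [exact: E | exact: mulmx1C E | move=> v w; exact: bilin_fun_calc].
Qed.

Lemma resolvent_quad n (A RA : 'M[C]_n) t (v : 'cV[C]_n) : is_resolvent A RA t ->
  (v^t* *m RA *m v) 0 0 = (\sum_i mass A v i / (t - eigval A i))%:C.
Proof.
case=> _ _ ->; rewrite rmorph_sum; apply: eq_bigr => i _.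
by rewrite mulcJ -rmorphM.
Qed.

Lemma resolvent_conj n (A RA : 'M[C]_n) t (v w : 'cV[C]_n) : is_resolvent A RA t ->
  (w^t* *m RA *m v) 0 0 = Num.conj ((v^t* *m RA *m w) 0 0).
Proof.
case=> _ _ RE; rewrite !RE [RHS]rmorph_sum; apply: eq_bigr => i _.
exact: (esym (conj_mul_real _ _ _)).
Qed.

(** The resolvent identity R_B = R_A + R_B w w^* R_A, evaluated at the pairs (v, v) and (v, w); the
    unknown v^* R_B w is then eliminated. *)
Lemma rank1_resolvent n (A B RA RB : 'M[C]_n) (v w : 'cV[C]_n) (t : C) :
    B = A + w *m w^t* -> (t%:M - A) *m RA = 1%:M -> RB *m (t%:M - B) = 1%:M ->
  ((v^t* *m RB *m v) 0 0 - (v^t* *m RA *m v) 0 0) * (1 - (w^t* *m RA *m w) 0 0) =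
  (v^t* *m RA *m w) 0 0 * (w^t* *m RA *m v) 0 0.
Proof.
move=> BE RAE RBE.
have RD : RB = RA + RB *m w *m w^t* *m RA.
  have -> : RB *m w *m w^t* *m RA = RB *m ((t%:M - A) - (t%:M - B)) *m RA.
    by rewrite opprB addrC addrA subrK BE addrAC subrr add0r !mulmxA.
  by rewrite mulmxBr mulmxBl -mulmxA RAE mulmx1 RBE mul1mx addrC subrK.
have scM (M N : 'M[C]_1) : (M *m N) 0 0 = M 0 0 * N 0 0 by rewrite mxE big_ord1.
have e1 : (v^t* *m RB *m v) 0 0 = (v^t* *m RA *m v) 0 0
    + (v^t* *m RB *m w) 0 0 * (w^t* *m RA *m v) 0 0.
  by rewrite {1}RD mulmxDr mulmxDl mxE -scM !mulmxA.
have e2 : (v^t* *m RB *m w) 0 0 = (v^t* *m RA *m w) 0 0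
    + (v^t* *m RB *m w) 0 0 * (w^t* *m RA *m w) 0 0.
  by rewrite {1}RD mulmxDr mulmxDl mxE -scM !mulmxA.
rewrite e1 addrAC subrr add0r.
rewrite mulrAC mulrBr mulr1 {1}e2 addrK.
by [].
Qed.

Lemma rank1_det n (A B RA : 'M[C]_n) (w : 'cV[C]_n) (t : C) :
    B = A + w *m w^t* -> (t%:M - A) *m RA = 1%:M ->
  \det (t%:M - B) = \det (t%:M - A) * (1 - (w^t* *m RA *m w) 0 0).
Proof.
move=> BE RAE.
have E : t%:M - B = (t%:M - A) *m (1%:M - (RA *m w) *m w^t*).
  by rewrite mulmxBr mulmx1 !mulmxA RAE mul1mx BE opprD addrA.
by rewrite E det_mulmx det_sub_rank1 mulmxA.
Qed.

(** Off the spectra, [rank1_resolvent] and [rank1_det] express the difference of the resolvent forms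
    at v as |v^* R_A w|^2 chi_A / chi_B. The real and imaginary parts of v^* R_A w yield the two
    squares. *)
Lemma rank1_numer n (A B : 'M[C]_n) (v w : 'cV[C]_n)
    (c := fun i => Num.conj ((spectralmx A *m v) i 0) * (spectralmx A *m w) i 0) :
    A \is hermsymmx -> B \is hermsymmx -> B = A + w *m w^t* ->
  numer (eigval B) (mass B v) * nodal (eigval A) - numer (eigval A) (mass A v) * nodal (eigval B)
  = numer (eigval A) (fun i => complex.Re (c i)) ^+ 2
    + numer (eigval A) (fun i => complex.Im (c i)) ^+ 2.
Proof.
move=> hA hB BE; apply/eqP; rewrite -subr_eq0; apply/eqP.
set NA := numer _ (mass A v); set NB := numer _ (mass B v).
set N1 := numer _ _; set N2 := numer _ _.
set XA := nodal (eigval A); set XB := nodal (eigval B).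
have XX0 : XA * XB != 0 by rewrite mulf_neq0 // monic_neq0 // nodal_monic.
(* The factor chi_A chi_B makes the identity trivial at eigenvalues, so resolvents are used only
   where they exist. *)
apply: (mulIf XX0); rewrite mul0r; apply: poly_eq0_horner => t.
rewrite !(hornerM, hornerD, hornerN).
have [->|XA0] := eqVneq XA.[t] 0; first by rewrite mul0r mulr0.
have [->|XB0] := eqVneq XB.[t] 0; first by rewrite !mulr0.
apply/eqP; rewrite mulf_eq0; apply/orP; left; rewrite subr_eq0; apply/eqP.
have [RA RAP] := resolvent_exists hA (fun i => nodal_neq0 i XA0).
have [RB RBP] := resolvent_exists hB (fun i => nodal_neq0 i XB0).
have [RAE _ _] := RAP; have [_ RBE _] := RBP.
have detE := rank1_det BE RAE.
have resE := rank1_resolvent v BE RAE RBE.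
rewrite -(resolventE t hA) -(resolventE t hB) !det_fun_calc in detE.
have nodalt (M : 'M[C]_n) : \prod_i (t - eigval M i) = (nodal (eigval M)).[t].
  by rewrite /nodal horner_prod_XsubC.
rewrite !nodalt -/XA -/XB in detE.
rewrite (resolvent_quad v RAP) (resolvent_quad v RBP) (resolvent_conj v w RAP) in resE.
rewrite !horner_numer // -/NA -/NB -/XA -/XB in resE.
have yE : (v^t* *m RA *m w) 0 0 = \sum_i c i * ((t - eigval A i)^-1)%:C by have [_ _ ->] := RAP.
move: detE resE yE.
move: ((w^t* *m RA *m w) 0 0) ((v^t* *m RA *m w) 0 0) => x y detE resE yE.
have scale_real (z : C) (r : R) : complex.Re (z * r%:C) = complex.Re z * r /\
    complex.Im (z * r%:C) = complex.Im z * r.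
  by case: z => p q; split; rewrite /= mulr0 ?subr0 ?add0r.
have ReD : {morph (@complex.Re R) : z z' / z + z'} by move=> [? ?] [? ?].
have ImD : {morph (@complex.Im R) : z z' / z + z'} by move=> [? ?] [? ?].
have yRe : complex.Re y = N1.[t] / XA.[t].
  rewrite -horner_numer // yE (big_morph _ ReD (erefl _)).
  by apply: eq_bigr => i _; rewrite (scale_real _ _).1.
have yIm : complex.Im y = N2.[t] / XA.[t].
  rewrite -horner_numer // yE (big_morph _ ImD (erefl _)).
  by apply: eq_bigr => i _; rewrite (scale_real _ _).2.
move: resE; rewrite mulrC [RHS]mulrC mulcJ => /(congr1 ( *%R (XA.[t])%:C)).
rewrite mulrA -detE -!rmorphB -!rmorphM => /(@complexI R); rewrite /sqnormc yRe yIm => E.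
have : XA.[t] * (XB.[t] * (NB.[t] / XB.[t] - NA.[t] / XA.[t])) =
  XA.[t] * (XA.[t] * ((N1.[t] / XA.[t]) ^+ 2 + (N2.[t] / XA.[t]) ^+ 2)) by rewrite E.
have -> : XA.[t] * (XB.[t] * (NB.[t] / XB.[t] - NA.[t] / XA.[t])) =
  NB.[t] * XA.[t] - NA.[t] * XB.[t] by field; rewrite XA0 XB0.
by move=> ->; field; rewrite XA0.
Qed.

End RankOne.

(** * Monotonicity along rank-one steps from A to B *)

Section Chain.
Variable R : realType.
Local Notation C := R[i].

(** With g interpolated by G on both spectra, the difference of the forms is the residue of G (N1^2
    + N2^2) / (chi_A chi_B). The list [undup s] witnesses that this rational function without G has
    only simple poles. *)
Lemma rank1_monotone n a b (g : R -> R) (A B : 'M[C]_n) (w v : 'cV[C]_n) :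
    (forall k (x : 'I_(k.*2) -> R) (q : {poly R}), (k <= n)%N -> (forall i, in_oo a b (x i)) ->
       injective x -> (size q <= k)%N -> 0 <= divdiff (fun y => g y * q.[y] ^+ 2) x) ->
    A \is hermsymmx -> B \is hermsymmx -> B = A + w *m w^t* ->
    (forall i, in_oo a b (eigval A i)) -> (forall i, in_oo a b (eigval B i)) ->
  quad (fun_calc g A) v <= quad (fun_calc g B) v.
Proof.
move=> gpos hA hB BE Aab Bab.
pose s := [seq eigval A i | i <- enum 'I_n] ++ [seq eigval B i | i <- enum 'I_n].
have As i : eigval A i \in s by rewrite mem_cat map_f // mem_enum.
have Bs i : eigval B i \in s by rewrite mem_cat map_f ?orbT // mem_enum.
have [G GP] := poly_interp g s.
rewrite [X in X <= _]quad_fun_calc [X in _ <= X]quad_fun_calc lecR -subr_ge0.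
under eq_bigr do rewrite -GP //.
under [X in _ <= _ - X]eq_bigr do rewrite -GP //.
rewrite -!presidue_numer.
set NA := numer _ (mass A v); set NB := numer _ (mass B v).
set XA := nodal (eigval A); set XB := nodal (eigval B).
have XAm : XA \is monic by exact: nodal_monic.
have XBm : XB \is monic by exact: nodal_monic.
rewrite -(presidue_mul2r _ XBm XAm) -(presidue_mul2r _ XAm XBm) [XB * XA]mulrC.
rewrite -presidueN -presidueD -!mulrA -mulrBr (rank1_numer v hA hB BE).
have XE : XA * XB = \prod_(y <- s) ('X - y%:P).
  by rewrite /s big_cat !big_map -!enumT !big_enum.
have th_mem y : y \in s -> y \in undup s by rewrite mem_undup.
have [PA PAE] := numer_simple_poles (mass A v) (fun i => th_mem _ (As i)).
have [PB PBE] := numer_simple_poles (mass B v) (fun i => th_mem _ (Bs i)).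
rewrite XE; apply: (presidue_sumsqr_ge0 gpos (k := n) (th := undup s) (P := PB - PA)) => //.
- by rewrite size_cat !size_map -enumT size_enum_ord addnn.
- by move=> y; rewrite mem_cat => /orP[] /mapP[i _ ->].
- exact: undup_uniq.
- exact: size_numer.
- exact: size_numer.
rewrite -(rank1_numer v hA hB BE) -XE -/NA -/NB -/XA -/XB.
transitivity (XA * (NB * \prod_(y <- undup s) ('X - y%:P))
   - XB * (NA * \prod_(y <- undup s) ('X - y%:P))); first by ring.
by rewrite PAE PBE -/XA -/XB; ring.
Qed.

(** The spectral decomposition of B - A, with nonnegative eigenvalues, is added to [A] one
    eigenvector at a time. Each partial sum lies between [A] and [B], so its spectrum stays in (a,
    b). *)
Lemma matrix_monotone_divdiff n a b (g : R -> R) : (0 < n)%N ->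
    (forall k (x : 'I_(k.*2) -> R) (q : {poly R}), (k <= n)%N -> (forall i, in_oo a b (x i)) ->
       injective x -> (size q <= k)%N -> 0 <= divdiff (fun y => g y * q.[y] ^+ 2) x) ->
  matrix_monotone n a b g.
Proof.
move=> n0 gpos A B hA hB sA sB AB.
have Aab := (spectrum_in_eigval a b hA).1 sA.
have Bab := (spectrum_in_eigval a b hB).1 sB.
have quadAB := (loewner_leE hA hB).1 AB.
pose E := B - A; have hE : E \is hermsymmx by exact: hermsymmxB.
have E0 k : 0 <= eigval E k.
  by rewrite -lecR -(quad_eigvec k hE) quadB subr_ge0.
pose cut m (k : 'I_n) := if (k < m)%N then eigval E k else 0.
pose M m := A + specmx E (cut m).
have hM m : M m \is hermsymmx by exact: hermsymmxD hA (specmx_hermsymmx _ _).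
have M0 : M 0 = A.
  rewrite /M /specmx (_ : diag_mx _ = 0) ?mulmx0 ?mul0mx ?addr0 //.
  by apply/matrixP => i j; rewrite !mxE mul0rn.
have Mn : M n = B.
  have -> : B = A + E by rewrite /E addrC subrK.
  rewrite -[in RHS](fun_calc_id hE) fun_calcE /M; congr (A + specmx E _).
  by apply/funext => k; rewrite /cut ltn_ord.
have MS (m : 'I_n) : exists w : 'cV_n, M m.+1 = M m + w *m w^t*.
  (* The m-th eigenvector of B - A scaled by the square root of its eigenvalue. *)
  exists ((spectralmx E)^t* *m ((Num.sqrt (eigval E m))%:C *: delta_mx m 0)).
  rewrite /M -addrA; congr (A + _); rewrite trmx_mul map_mxM trmxCK mulmxA.
  rewrite -(mulmxA _ _ ((_ *: delta_mx m 0)^t*)).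
  have -> : (Num.sqrt (eigval E m))%:C *: delta_mx m 0 *m
      ((Num.sqrt (eigval E m))%:C *: delta_mx m 0 : 'cV[C]_n)^t*
    = diag_mx (\row_k (if k == m then eigval E m else 0)%:C).
    apply/matrixP => i j; rewrite !mxE big_ord1 !mxE /= andbT.
    rewrite eqxx andbT; have [->|im] := eqVneq i m; last by rewrite mulr0 mul0r mul0rn.
    rewrite eq_sym; have [->|jm] := eqVneq m j; last by rewrite mulr0 rmorph0 mulr0 mulr0n.
    rewrite !mulr1 mulr1n; have -> := conj_real (Num.sqrt (eigval E j)).
    by rewrite -rmorphM -expr2 sqr_sqrtr.
  rewrite /specmx -mulmxDl -mulmxDr -linearD /=.
  have -> // : \row_k (cut m.+1 k)%:C = \row_k (cut m k)%:C
      + \row_k (if k == m then eigval E m else 0)%:C :> 'rV[C]_n.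
  apply/rowP => k; rewrite !mxE -rmorphD /cut ltnS leq_eqVlt -val_eqE /=.
  by case: eqVneq => [/val_inj ->|km] /=; rewrite ?ltnn ?add0r ?addr0.
have AM m v : quad A v <= quad (M m) v.
  rewrite [leRHS]quadD lerDl quad_specmx lecR; apply: sumr_ge0 => k _.
  by rewrite mulr_ge0 ?mass_ge0 // /cut; case: ifP.
have MB m v : quad (M m) v <= quad B v.
  rewrite -Mn [leLHS]quadD [leRHS]quadD lerD2l [leLHS]quad_specmx [leRHS]quad_specmx lecR.
  apply: ler_sum => k _; rewrite ler_wpM2l ?mass_ge0 // /cut ltn_ord.
  by case: ifP.
have [|l [h [rho [rho0 lab hab bnd]]]] := @in_oo_compact R a b (eigval A (Ordinal n0))
    ([seq eigval A i | i <- enum 'I_n] ++ [seq eigval B i | i <- enum 'I_n]) (Aab _).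
  by move=> x; rewrite mem_cat => /orP[] /mapP[i _ ->].
have Al i : l <= eigval A i.
  have /andP[+ _] : l + rho <= eigval A i <= h - rho.
    by apply: bnd; rewrite inE mem_cat map_f ?orbT // mem_enum.
  by apply: le_trans; rewrite lerDl ltW.
have Bh i : eigval B i <= h.
  have /andP[_] : l + rho <= eigval B i <= h - rho.
    by apply: bnd; rewrite inE mem_cat [X in _ || (_ || X)]map_f ?orbT // mem_enum.
  by move=> /le_trans; apply; rewrite gerBl ltW.
have Mab m i : in_oo a b (eigval (M m) i).
  apply: (in_oo_between lab hab).
  exact: (eigval_between hA (hM m) hB (AM m) (MB m) Al Bh).
apply/loewner_leE; [exact: fun_calc_hermsymmx | exact: fun_calc_hermsymmx | move=> v].
have main m : (m <= n)%N -> quad (fun_calc g A) v <= quad (fun_calc g (M m)) v.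
  elim: m => [|m IH] mn; first by rewrite M0.
  apply: le_trans (IH (ltnW mn)) _.
  have [w MSE] := MS (Ordinal mn).
  exact: rank1_monotone gpos (hM m) (hM m.+1) MSE (Mab m) (Mab m.+1).
by rewrite -[in leRHS]Mn; exact: main.
Qed.

End Chain.

Theorem corollary26 (R : realType) (n : nat) (a b : \bar R) (f : R -> R)
    (hn : (2 <= n)%N) (hf : matrix_convex n a b f)
    (lambda0 : R) (hlambda0 : in_oo a b lambda0) :
  matrix_monotone n a b (fun x : R => divided_difference f x lambda0).
Proof.
apply: matrix_monotone_divdiff => [|k x q kn xab xI sq]; first exact: ltnW.
exact: (divided_difference_divdiff hn kn hf hlambda0 xab xI sq).
Qed.
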